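(* Let $R$ and $S$ be associative rings and let ${}_SC_R$ be a faithfully semidualizing $(S,R)$-bimodule. The class $\mathcal{A}_C(R)$ contains all $R$-modules of finite flat dimension, the class $\mathcal{A}_C^f(R)$ contains all finitely generated $R$-modules of finite flat dimension, and the class $\mathcal{B}_C(S)$ contains all $S$-modules of finite injective dimension.
   Context: Rings are associative with unity (not necessarily commutative or noetherian). Modules are unital left modules; right $R$-modules are identified with left $R^{\mathrm{op}}$-modules. For a class $\mathcal{X}$ of modules, $\mathcal{X}^f$ is the subclass of finitely generated modules in $\mathcal{X}$. An $(S,R)$-bimodule $C={}_SC_R$ is semidualizing if: (a1) ${}_SC$ admits a degreewise finite $S$-projective resolution (a projective resolution by finitely generated projectives); (a2) $C_R$ admits a degreewise finite $R^{\mathrm{op}}$-projective resolution; (b1) the homothety map $S\to\operatorname{Hom}_{R^{\mathrm{op}}}(C,C)$, $s\mapsto(x\mapsto sx)$, is an isomorphism; (b2) the homothety map $R\to\operatorname{Hom}_S(C,C)$, $r\mapsto(x\mapsto xr)$, is an isomorphism; (c1) $\operatorname{Ext}_S^{i}(C,C)=0$ for all $i\geq1$; (c2) $\operatorname{Ext}_{R^{\mathrm{op}}}^{i}(C,C)=0$ for all $i\geq 1$. It is faithfully semidualizing if moreover, for all left $S$-modules $N$ and right $R$-modules $M$: $\operatorname{Hom}_S(C,N)=0$ implies $N=0$, and $\operatorname{Hom}_{R^{\mathrm{op}}}(C,M)=0$ implies $M=0$. The Auslander class $\mathcal{A}_C(R)$ consists of all $R$-modules $M$ with (A1) $\operatorname{Tor}^R_i(C,M)=0$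 for all $i\ge1$; (A2) $\operatorname{Ext}_S^i(C,C\otimes_RM)=0$ for all $i\ge1$; (A3) the natural map $\mu_M\colon M\to\operatorname{Hom}_S(C,C\otimes_RM)$, $m\mapsto(c\mapsto c\otimes m)$, is an isomorphism. The Bass class $\mathcal{B}_C(S)$ consists of all $S$-modules $N$ with (B1) $\operatorname{Ext}_S^i(C,N)=0$ for all $i\ge1$; (B2) $\operatorname{Tor}_i^R(C,\operatorname{Hom}_S(C,N))=0$ for all $i\ge1$; (B3) the natural evaluation map $\nu_N\colon C\otimes_R\operatorname{Hom}_S(C,N)\to N$, $c\otimes f\mapsto f(c)$, is an isomorphism. *)

(* Defs.v *)
From HB Require Import structures.
From mathcomp Require Import all_boot all_algebra.
From mathcomp Require Import boolp.
From mathcomp Require Import generic_quotient ring_quotient freeg.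

Set Implicit Arguments.
Unset Strict Implicit.
Unset Printing Implicit Defensive.

Import GRing.Theory.
Local Open Scope ring_scope.
Local Open Scope quotient_scope.

(* Rings are [pzRingType]s: associative, unital, possibly zero.  Left         *)
(* R-modules are [lmodType R]s and right R-modules are [lmodType R^c]s, where *)
(* R^c is the opposite ring.                                                  *)

HB.mixin Record Lmodule_isBimodule (S R : pzRingType) C
    of GRing.Lmodule S C := {
  rscale : C -> R -> C;
  rscaleA : forall c r r', rscale (rscale c r) r' = rscale c (r * r');
  rscale1 : forall c, rscale c 1 = c;
  rscaleDl : forall c c' r, rscale (c + c') r = rscale c r + rscale c' r;
  rscaleDr : forall c r r', rscale c (r + r') = rscale c r + rscale c r';
  rscaleAl : forall (s : S) c r, s *: rscale c r = rscale (s *: c) r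
}.

#[short(type="bimodType")]
HB.structure Definition Bimodule (S R : pzRingType) :=
  {C of Lmodule_isBimodule S R C & GRing.Lmodule S C}.

(* The underlying right R-module of an (S,R)-bimodule. *)
Definition rmod (S R : pzRingType) (C : bimodType S R) : Type := C.

Section RightModule.
Variables (S R : pzRingType) (C : bimodType S R).

HB.instance Definition _ := GRing.Zmodule.on (rmod C).

Let rsc (r : R^c) (c : rmod C) : rmod C := rscale (c : C) (r : R).

Fact rmod_scaleA a b v : rsc a (rsc b v) = rsc (a * b) v.
Proof. exact: rscaleA. Qed.
Fact rmod_scale1 : left_id 1 rsc.
Proof. exact: rscale1. Qed.
Fact rmod_scaleDr : right_distributive rsc +%R.
Proof. by move=> r c c'; apply: rscaleDl. Qed.
Fact rmod_scaleDl v : {morph rsc^~ v : a b / a + b}.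
Proof. by move=> r r'; apply: rscaleDr. Qed.

HB.instance Definition _ := GRing.Zmodule_isLmodule.Build R^c (rmod C)
  rmod_scaleA rmod_scale1 rmod_scaleDr rmod_scaleDl.

Lemma rmod_scaleE (r : R) (c : C) :
  (r : R^c) *: (c : rmod C) = rscale c r :> C.
Proof. by []. Qed.

End RightModule.

Section Hom.
Variables (R : pzRingType) (U V : lmodType R).

Definition linhom : Type := {linear U -> V}.
Definition fun_of_hom (f : linhom) : {linear U -> V} := f.
Coercion fun_of_hom : linhom >-> GRing.Linear.type.

HB.instance Definition _ := gen_eqMixin linhom.
HB.instance Definition _ := gen_choiceMixin linhom.

Lemma homP (f g : linhom) : f =1 g -> f = g.
Proof.
case: f => f cf; case: g => g cg /= fg.
move: cf cg; rewrite -(funext fg) => {fg} - [cf1 cf2] [cg1 cg2].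
congr GRing.Linear.Pack; congr GRing.Linear.Class.
- by case: cf1 cg1 => cf [cg]; rewrite (Prop_irrelevance cf cg).
- by case: cf2 cg2 => cf [cg]; rewrite (Prop_irrelevance cf cg).
Qed.

Let hom0 : linhom := (\0 : {linear U -> V}).
Let hom_opp (f : linhom) : linhom := (\- f : {linear U -> V}).
Let hom_add (f g : linhom) : linhom := (f \+ g : {linear U -> V}).

Fact hom_addA : associative hom_add.
Proof. by move=> f g h; apply: homP => x /=; rewrite addrA. Qed.
Fact hom_addC : commutative hom_add.
Proof. by move=> f g; apply: homP => x /=; rewrite addrC. Qed.
Fact hom_add0 : left_id hom0 hom_add.
Proof. by move=> f; apply: homP => x /=; rewrite add0r. Qed.
Fact hom_addN : left_inverse hom0 hom_opp hom_add.
Proof. by move=> f; apply: homP => x /=; rewrite addNr. Qed.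

HB.instance Definition _ :=
  GRing.isZmodule.Build linhom hom_addA hom_addC hom_add0 hom_addN.

End Hom.

(* Hom(d, N) *)
Definition hom_pre (R : pzRingType) (U U' N : lmodType R)
  (d : {linear U' -> U}) (f : linhom U N) : linhom U' N :=
  (f \o d : {linear U' -> N}).

(* Hom_S(C, N) as a left R-module: (r f)(c) = f(c r). *)
Definition bhom (S R : pzRingType) (C : bimodType S R) (N : lmodType S) : Type :=
  linhom C N.

Section BimoduleHom.
Variables (S R : pzRingType) (C : bimodType S R) (N : lmodType S).

HB.instance Definition _ := GRing.Zmodule.on (bhom C N).

Section Scale.
Variables (r : R) (f : bhom C N).
Let g (c : C) : N := (f : linhom C N) (rscale c r).
Fact bhom_scale_is_linear : linear g.
Proof. by move=> s c c'; rewrite /g rscaleDl -rscaleAl linearP. Qed.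
HB.instance Definition _ := GRing.isLinear.Build S C N _ g bhom_scale_is_linear.
Definition bhom_scale : bhom C N := (g : {linear C -> N}).
End Scale.

Fact bhom_scaleA a b f : bhom_scale a (bhom_scale b f) = bhom_scale (a * b) f.
Proof. by apply: homP => c /=; rewrite rscaleA. Qed.
Fact bhom_scale1 : left_id 1 bhom_scale.
Proof. by move=> f; apply: homP => c /=; rewrite rscale1. Qed.
Fact bhom_scaleDr : right_distributive bhom_scale +%R.
Proof. by move=> r f g; apply: homP => c. Qed.
Fact bhom_scaleDl f : {morph bhom_scale^~ f : a b / a + b}.
Proof. by move=> a b; apply: homP => c /=; rewrite rscaleDr linearD. Qed.

HB.instance Definition _ := GRing.Zmodule_isLmodule.Build R (bhom C N)
  bhom_scaleA bhom_scale1 bhom_scaleDr bhom_scaleDl.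

Lemma bhomZE (r : R) (f : bhom C N) (c : C) :
  (r *: f : linhom C N) c = (f : linhom C N) (rscale c r).
Proof. by []. Qed.

End BimoduleHom.

(* The tensor product of a right and a left R-module: the free abelian group  *)
(* on A * M modulo the subgroup generated by the bilinearity relations.       *)
Section Tensor.
Variables (R : pzRingType) (A : lmodType R^c) (M : lmodType R).

Inductive tensor_rel : {freeg (A * M) / int} -> Prop :=
| Trel0 : tensor_rel 0
| TrelB x y : tensor_rel x -> tensor_rel y -> tensor_rel (x - y)
| TrelDl a a' m : tensor_rel (<<(a + a', m)>> - (<<(a, m)>> + <<(a', m)>>))
| TrelDr a m m' : tensor_rel (<<(a, m + m')>> - (<<(a, m)>> + <<(a, m')>>))
| TrelZ a (r : R) m :
    tensor_rel (<<((r : R^c) *: a, m)>> - <<(a, r *: m)>>).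

Definition tensor_ker : {pred {freeg (A * M) / int}} :=
  fun x => `[< tensor_rel x >].

Fact tensor_ker_zmod_closed : zmod_closed tensor_ker.
Proof.
split=> [|x y /asboolP hx /asboolP hy]; apply/asboolP; first exact: Trel0.
exact: TrelB.
Qed.
HB.instance Definition _ :=
  GRing.isZmodClosed.Build _ tensor_ker tensor_ker_zmod_closed.

Definition tensor : Type := Quotient.quot tensor_ker.
HB.instance Definition _ := GRing.Zmodule.on tensor.

Definition tens (a : A) (m : M) : tensor := \pi_(Quotient.quot tensor_ker) <<(a, m)>>.

Lemma tensor_pi_eq x y : tensor_rel (x - y) ->
  \pi_(Quotient.quot tensor_ker) x = \pi_(Quotient.quot tensor_ker) y.
Proof.
move=> h; apply/eqP; rewrite -Quotient.idealrBE; exact/asboolP.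
Qed.

Record balanced (V : zmodType) (f : A -> M -> V) : Prop := Balanced {
  balancedDl : forall a a' m, f (a + a') m = f a m + f a' m;
  balancedDr : forall a m m', f a (m + m') = f a m + f a m';
  balancedZ : forall a (r : R) m, f ((r : R^c) *: a) m = f a (r *: m)
}.

Lemma tens_balanced : balanced tens.
Proof.
split=> *; rewrite /tens -?[LHS]raddfD -?[RHS]raddfD; apply: tensor_pi_eq.
- exact: TrelDl.
- exact: TrelDr.
- exact: TrelZ.
Qed.

Lemma tensor_ind (P : tensor -> Prop) : P 0 ->
  (forall x y, P x -> P y -> P (x - y)) -> (forall a m, P (tens a m)) ->
  forall x, P x.
Proof.
move=> P0 PB Pt; elim/quotW => x.
have PN y : P y -> P (- y) by move=> Py; rewrite -sub0r; apply: PB.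
have PD y z : P y -> P z -> P (y + z).
  by move=> Py Pz; rewrite -[z]opprK; apply/PB/PN.
have -> : \pi x = \pi_(Quotient.quot tensor_ker) x by [].
elim/freeg_ind_dom0: x => [|k [a m] D _ _ IH]; first by rewrite raddf0.
rewrite raddfD; apply: (PD _ _ _ IH).
rewrite -[k]intz -freegU_mulz raddfMz.
have Pn n : P ((tens a m) *+ n).
  by elim: n => [|n IHn]; rewrite ?mulr0n // mulrS; apply: PD.
by case: k => n; [exact: Pn | rewrite NegzE mulrNz; apply: PN; apply: Pn].
Qed.

(* The additive map with tlift f (tens a m) = f a m, for f balanced. *)
Definition tlift (V : zmodType) (f : A -> M -> V) (x : tensor) : V :=
  fglift (fun p => f p.1 p.2 : zmodule V) (repr (x : Quotient.quot tensor_ker)).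

Section Lift.
Variables (V : zmodType) (f : A -> M -> V).
Hypothesis fb : balanced f.
Let F := fglift (fun p : A * M => f p.1 p.2 : zmodule V).

Let FB x y : F (x - y) = F x - F y.
Proof. exact: lift_is_additive. Qed.
Let FD x y : F (x + y) = F x + F y.
Proof. by rewrite -[y in LHS]opprK FB -sub0r FB -{1}(subrr 0) FB subrr sub0r opprK. Qed.
Let FU a m : F <<(a, m)>> = f a m.
Proof. by rewrite /F liftU scale1r. Qed.

Let F_rel x : tensor_rel x -> F x = 0.
Proof.
elim=> [|y z _ Fy _ Fz|a a' m|a m m'|a r m].
- by rewrite -(subrr 0) FB subrr.
- by rewrite FB Fy Fz subrr.
- by rewrite FB FD !FU (balancedDl fb) subrr.
- by rewrite FB FD !FU (balancedDr fb) subrr.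
- by rewrite FB !FU (balancedZ fb) subrr.
Qed.

Let tlift_pi x : tlift f (\pi_(Quotient.quot tensor_ker) x) = F x.
Proof.
apply/eqP; rewrite -subr_eq0 -[tlift _ _]/(F _) -FB; apply/eqP/F_rel.
apply/asboolP; have := Quotient.idealrBE tensor_ker
  (repr (\pi_(Quotient.quot tensor_ker) x)) x.
by rewrite reprK eqxx.
Qed.

Lemma tliftE a m : tlift f (tens a m) = f a m.
Proof. by rewrite tlift_pi FU. Qed.

Lemma tlift_is_zmod_morphism : zmod_morphism (tlift f).
Proof.
move=> x y; rewrite -[x](reprK (x : Quotient.quot tensor_ker)).
by rewrite -[y](reprK (y : Quotient.quot tensor_ker)) -raddfB !tlift_pi FB.
Qed.
End Lift.

Lemma tensor_ext (V : zmodType) (f g : {additive tensor -> V}) :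
  (forall a m, f (tens a m) = g (tens a m)) -> f =1 g.
Proof.
move=> fg; apply: tensor_ind => //; first by rewrite !raddf0.
by move=> x y fx fy; rewrite !raddfB fx fy.
Qed.

End Tensor.

(* f (x) g *)
Section TensorMap.
Variables (R : pzRingType) (A A' : lmodType R^c) (M M' : lmodType R).
Variables (f : {linear A -> A'}) (g : {linear M -> M'}).

Fact tensor_map_balanced : balanced (fun a m => tens (f a) (g m)).
Proof.
have [Dl Dr Z] := tens_balanced A' M'.
by split=> *; rewrite ?linearD ?linearZ ?Dl ?Dr ?Z.
Qed.

Definition tensor_map : tensor A M -> tensor A' M' :=
  tlift (fun a m => tens (f a) (g m)).

HB.instance Definition _ := GRing.isZmodMorphism.Build _ _ tensor_map
  (tlift_is_zmod_morphism tensor_map_balanced).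

Lemma tensor_mapE a m : tensor_map (tens a m) = tens (f a) (g m).
Proof. exact: tliftE tensor_map_balanced a m. Qed.
End TensorMap.

(* C (x)_R M as a left S-module: s (c (x) m) = (s c) (x) m. *)
Definition btensor (S R : pzRingType) (C : bimodType S R) (M : lmodType R) : Type :=
  tensor (rmod C) M.

Definition btens (S R : pzRingType) (C : bimodType S R) (M : lmodType R)
  (c : C) (m : M) : btensor C M := tens (c : rmod C) m.

Section BimoduleTensor.
Variables (S R : pzRingType) (C : bimodType S R) (M : lmodType R).
Local Notation T := (tensor (rmod C) M).

HB.instance Definition _ := GRing.Zmodule.on (btensor C M).

Let scl (s : S) (c : rmod C) (m : M) : T := tens (s *: (c : C) : rmod C) m.

Fact btensor_scale_balanced s : balanced (scl s).
Proof.
have [Dl Dr Z] := tens_balanced (rmod C) M.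
split=> [c c' m|c m m'|c r m]; rewrite /scl.
- by rewrite scalerDr; apply: Dl.
- exact: Dr.
- by rewrite -Z; congr tens; apply: rscaleAl.
Qed.

Definition btensor_scale (s : S) : T -> T := tlift (scl s).

HB.instance Definition _ s := GRing.isZmodMorphism.Build _ _ (btensor_scale s)
  (tlift_is_zmod_morphism (btensor_scale_balanced s)).

Lemma btensor_scaleE s c m :
  btensor_scale s (tens (c : rmod C) m) = tens (s *: (c : C) : rmod C) m.
Proof. exact: tliftE (btensor_scale_balanced s) _ _. Qed.

Fact btensor_scaleA a b v :
  btensor_scale a (btensor_scale b v) = btensor_scale (a * b) v.
Proof.
move: v; apply: (tensor_ext (f := btensor_scale a \o btensor_scale b)) => c m /=.
by rewrite !btensor_scaleE scalerA.
Qed.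
Fact btensor_scale1 : left_id 1 btensor_scale.
Proof.
apply: (tensor_ext (g := idfun)) => c m /=.
by rewrite btensor_scaleE scale1r.
Qed.
Fact btensor_scaleDr : right_distributive btensor_scale +%R.
Proof. by move=> s x y; rewrite raddfD. Qed.
Fact btensor_scaleDl v : {morph btensor_scale^~ v : a b / a + b}.
Proof.
move=> a b; move: v.
apply: (tensor_ext (g := btensor_scale a \+ btensor_scale b)) => c m /=.
rewrite !btensor_scaleE scalerDl.
exact: balancedDl (tens_balanced (rmod C) M) _ _ _.
Qed.

HB.instance Definition _ := GRing.Zmodule_isLmodule.Build S (btensor C M)
  btensor_scaleA btensor_scale1 btensor_scaleDr btensor_scaleDl.

Lemma btens_scale s (c : C) (m : M) : s *: btens c m = btens (s *: c) m.
Proof. exact: btensor_scaleE. Qed.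

End BimoduleTensor.

Section HomologicalNotions.
Variable R : pzRingType.

Definition trivial_group (V : zmodType) : Prop := forall x : V, x = 0.

Definition exact_at (U V W : zmodType) (f : U -> V) (g : V -> W) : Prop :=
  forall y, g y = 0 <-> exists x, f x = y.

Definition finitely_generated (M : lmodType R) : Prop :=
  exists (n : nat) (e : 'I_n -> M),
    forall x, exists a : 'I_n -> R, x = \sum_(i < n) a i *: e i.

Definition projective (P : lmodType R) : Prop :=
  forall (A B : lmodType R) (p : {linear A -> B}) (f : {linear P -> B}),
    (forall b, exists a, p a = b) ->
    exists g : {linear P -> A}, forall x, p (g x) = f x.

Definition injective_module (E : lmodType R) : Prop :=
  forall (A B : lmodType R) (j : {linear A -> B}) (f : {linear A -> E}),
    injective j -> exists g : {linear B -> E}, forall x, g (j x) = f x.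

(* The functor - (x)_R F is exact. *)
Definition flat (F : lmodType R) : Prop :=
  forall (A B D : lmodType R^c) (f : {linear A -> B}) (g : {linear B -> D}),
    exact_at f g ->
    exact_at (tensor_map f (idfun : {linear F -> F}))
             (tensor_map g (idfun : {linear F -> F})).

(* ... -> P 1 -> P 0 -> M -> 0 exact *)
Record resolution (M : lmodType R) := Resolution {
  res_obj :> nat -> lmodType R;
  res_diff : forall i, {linear res_obj i.+1 -> res_obj i};
  res_aug : {linear res_obj 0%N -> M};
  res_aug_surj : forall x, exists y, res_aug y = x;
  res_exact0 : exact_at (res_diff 0%N) res_aug;
  res_exact : forall i, exact_at (res_diff i.+1) (res_diff i)
}.

(* 0 -> M -> I 0 -> I 1 -> ... exact *)
Record coresolution (M : lmodType R) := Coresolution {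
  cores_obj :> nat -> lmodType R;
  cores_diff : forall i, {linear cores_obj i -> cores_obj i.+1};
  cores_aug : {linear M -> cores_obj 0%N};
  cores_aug_inj : injective cores_aug;
  cores_exact0 : exact_at cores_aug (cores_diff 0%N);
  cores_exact : forall i, exact_at (cores_diff i) (cores_diff i.+1)
}.

Definition has_degreewise_finite_proj_resolution (M : lmodType R) : Prop :=
  exists P : resolution M,
    forall i, projective (P i) /\ finitely_generated (P i).

Definition finite_flat_dimension (M : lmodType R) : Prop :=
  exists (F : resolution M) (n : nat),
    (forall i, flat (F i)) /\ (forall i, (n < i)%N -> trivial_group (F i)).

Definition finite_injective_dimension (M : lmodType R) : Prop :=
  exists (E : coresolution M) (n : nat),
    (forall i, injective_module (E i)) /\
    (forall i, (n < i)%N -> trivial_group (E i)).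

(* Ext_R^i(M, N) = 0: the i-th cohomology of the complex                      *)
(* 0 -> Hom(P 0, N) -> Hom(P 1, N) -> ... vanishes, P -> M any projective     *)
(* resolution (the cohomology does not depend on the choice of P).            *)
Definition Ext_eq0 (i : nat) (M N : lmodType R) : Prop :=
  forall P : resolution M, (forall j, projective (P j)) ->
    match i with
    | 0%N => forall f : linhom (P 0%N) N, hom_pre (res_diff P 0%N) f = 0 -> f = 0
    | j.+1 => exact_at (hom_pre (N := N) (res_diff P j))
                       (hom_pre (N := N) (res_diff P j.+1))
    end.

End HomologicalNotions.

(* Tor^R_i(A, M) = 0: the i-th homology of the complex                        *)
(* ... -> P 1 (x) M -> P 0 (x) M -> 0 vanishes, P -> A any projective         *)
(* resolution of the right module A.                                          *)
Definition Tor_eq0 (R : pzRingType) (i : nat) (A : lmodType R^c)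
    (M : lmodType R) : Prop :=
  forall P : resolution A, (forall j, projective (P j)) ->
    let d j := tensor_map (res_diff P j) (idfun : {linear M -> M}) in
    match i with
    | 0%N => forall y : tensor (P 0%N) M, exists x, d 0%N x = y
    | j.+1 => exact_at (d j.+1) (d j)
    end.

Section Homotheties.
Variables (S R : pzRingType) (C : bimodType S R).

Section Left.
Variable s : S.
Let h (x : rmod C) : rmod C := s *: (x : C).
Fact homothety_l_is_linear : linear h.
Proof.
move=> r x y; rewrite /h [LHS](scalerDr s (_ : C)); congr (_ + _).
exact: rscaleAl.
Qed.
HB.instance Definition _ :=
  GRing.isLinear.Build R^c (rmod C) (rmod C) _ h homothety_l_is_linear.
Definition homothety_l : linhom (rmod C) (rmod C) :=
  (h : {linear rmod C -> rmod C}).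
End Left.

Section Right.
Variable r : R.
Let h (x : C) : C := rscale x r.
Fact homothety_r_is_linear : linear h.
Proof. by move=> s x y; rewrite /h rscaleDl rscaleAl. Qed.
HB.instance Definition _ :=
  GRing.isLinear.Build S C C _ h homothety_r_is_linear.
Definition homothety_r : linhom C C := (h : {linear C -> C}).
End Right.

Record semidualizing : Prop := Semidualizing {
  sd_a1 : has_degreewise_finite_proj_resolution C;
  sd_a2 : has_degreewise_finite_proj_resolution (rmod C);
  sd_b1 : bijective homothety_l;
  sd_b2 : bijective homothety_r;
  sd_c1 : forall i, (1 <= i)%N -> Ext_eq0 i C C;
  sd_c2 : forall i, (1 <= i)%N -> Ext_eq0 i (rmod C) (rmod C)
}.

Record faithfully_semidualizing : Prop := FaithfullySemidualizing {
  fsd_sd : semidualizing;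
  fsd_l : forall N : lmodType S,
    trivial_group (linhom C N) -> trivial_group N;
  fsd_r : forall M : lmodType R^c,
    trivial_group (linhom (rmod C) M) -> trivial_group M
}.

End Homotheties.

Section UnitCounit.
Variables (S R : pzRingType) (C : bimodType S R).
Variables (M : lmodType R) (N : lmodType S).

Section Unit.
Variable m : M.
Let h (c : C) : btensor C M := btens c m.
Fact mu_at_is_linear : linear h.
Proof.
move=> s c c'; rewrite /h btens_scale.
exact: (balancedDl (tens_balanced (rmod C) M)).
Qed.
HB.instance Definition _ :=
  GRing.isLinear.Build S C (btensor C M) _ h mu_at_is_linear.
Definition mu : bhom C (btensor C M) := (h : {linear C -> btensor C M}).
End Unit.

Fact mu_is_linear : linear mu.
Proof.
have [_ Dr Z] := tens_balanced (rmod C) M.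
move=> r m m'; apply: homP => c /=.
by rewrite [LHS]Dr -Z.
Qed.
HB.instance Definition _ :=
  GRing.isLinear.Build R M (bhom C (btensor C M)) _ mu mu_is_linear.

Lemma muE (m : M) (c : C) : (mu m : linhom C (btensor C M)) c = btens c m.
Proof. by []. Qed.

Let ev (c : rmod C) (f : bhom C N) : N := (f : linhom C N) (c : C).

Fact ev_balanced : balanced ev.
Proof. by split=> *; rewrite /ev ?linearD. Qed.

Definition nu : btensor C (bhom C N) -> N := tlift ev.

Lemma nuE (c : C) (f : bhom C N) : nu (btens c f) = (f : linhom C N) c.
Proof. exact: tliftE ev_balanced _ _. Qed.

HB.instance Definition _ :=
  GRing.isZmodMorphism.Build (btensor C (bhom C N)) N nu
    (tlift_is_zmod_morphism ev_balanced).
Fact nu_is_scalable : scalable nu.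
Proof.
move=> s; apply: (tensor_ext (f := nu \o btensor_scale s)
  (g := ( *:%R s : {additive N -> N}) \o nu)) => c f /=.
by rewrite btensor_scaleE !nuE linearZ.
Qed.
HB.instance Definition _ :=
  GRing.isScalable.Build S (btensor C (bhom C N)) N _ nu nu_is_scalable.

End UnitCounit.

Record auslander (S R : pzRingType) (C : bimodType S R) (M : lmodType R) : Prop :=
  Auslander {
    auslander_A1 : forall i, (1 <= i)%N -> Tor_eq0 i (rmod C) M;
    auslander_A2 : forall i, (1 <= i)%N -> Ext_eq0 i C (btensor C M);
    auslander_A3 : bijective (@mu S R C M)
  }.

Record bass (S R : pzRingType) (C : bimodType S R) (N : lmodType S) : Prop :=
  Bass {
    bass_B1 : forall i, (1 <= i)%N -> Ext_eq0 i C N;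
    bass_B2 : forall i, (1 <= i)%N -> Tor_eq0 i (rmod C) (bhom C N);
    bass_B3 : bijective (@nu S R C N)
  }.

(* The subclass X^f of finitely generated modules in a class X. *)
Definition fg_part (R : pzRingType) (X : lmodType R -> Prop) (M : lmodType R) : Prop :=
  X M /\ finitely_generated M.

(* Main.v *)
Require Import Defs.
From HB Require Import structures.
From mathcomp Require Import all_boot all_algebra.
From mathcomp Require Import boolp generic_quotient ring_quotient.

Set Implicit Arguments.
Unset Strict Implicit.
Unset Printing Implicit Defensive.

Import GRing.Theory.
Local Open Scope ring_scope.
Local Open Scope quotient_scope.

(* Let P and Q be resolutions of C by finitely generated projectives, on the  *)
(* left and on the right.  A projective X with a finite dual basis makes the  *)
(* evaluation maps                                                            *)
(*   Hom_S(X, C) (x) F -> Hom_S(X, C (x) F)            (X = P_i)              *)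
(*   X (x) Hom_S(C, E) -> Hom_S(Hom_R^op(X, C), E)     (X = Q_i)              *)
(* bijective.  Applying - (x) F, F flat, to the exact complex                 *)
(*   0 -> R -> Hom_S(P_0, C) -> Hom_S(P_1, C) -> ...                          *)
(* puts F in the Auslander class; applying Hom_S(-, E), E injective, to       *)
(*   0 -> S -> Hom_R^op(Q_0, C) -> Hom_R^op(Q_1, C) -> ...                    *)
(* puts E in the Bass class.  By faithfulness the Auslander class is closed   *)
(* under cokernels of monomorphisms: if 0 -> M' -> M -> M'' -> 0 is exact     *)
(* with M' and M in the class, then K = ker (C (x) M' -> C (x) M) satisfies   *)
(* Hom_S(C, K) = ker (M' -> M) = 0, so that K = 0 and the long exact          *)
(* sequences apply.  Dually, the Bass class is closed under kernels of        *)
(* epimorphisms N -> N'': the cokernel K of Hom_S(C, N) -> Hom_S(C, N'') has  *)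
(* C (x) K = 0, so Hom_R^op(C, Hom_Z(K, K)) = 0, hence Hom_Z(K, K) = 0 and    *)
(* K = 0.  The result follows by induction on the length of the resolution.   *)

(** * Kernels, cokernels and liftings *)

(** Resolutions of finite length are consumed one term at a time, so each class needs a base case
    and a closure property. In the base cases [flat_in_auslander] and [injective_in_bass], the
    finitely generated projectives resolving C make the evaluations [thom] and [homt] bijective
    ([thom_bij], [homt_bij]). The vanishing of Ext(C, C) makes the dualized resolutions exact, and
    flatness or injectivity preserves that exactness. Comparing low degrees makes the evaluations
    bijective on C itself, and the homothety isomorphisms turn them into [mu] and [nu].

    The closure properties [auslander_coker] and [bass_ker] are long exact sequence arguments with
    one gap, in the lowest degree: C (x) M' -> C (x) M has to be injective, respectively Hom_S(C, N)
    -> Hom_S(C, N'') surjective. Faithfulness fills it, through [btensor_map_inj] and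
    [btensor_map_surj]. The chases [lift_cycle] and [lift_boundary] play the part of the long exact
    sequences, and [comparison] carries vanishing from the chosen resolutions of C to all others. *)

Section Kernel.
Variables (R : pzRingType) (U V : lmodType R) (f : {linear U -> V}).

Definition ker_pred : {pred U} := fun x => f x == 0.

Fact ker_pred_closed : submod_closed ker_pred.
Proof.
split=> [|a u v]; rewrite !unfold_in ?linear0 // => /eqP fu /eqP fv.
by rewrite linearP fu fv scaler0 addr0.
Qed.
HB.instance Definition _ :=
  GRing.isSubmodClosed.Build R U ker_pred ker_pred_closed.

Record kernel : Type := Kernel {ker_val : U; ker_valP : ker_val \in ker_pred}.
HB.instance Definition _ := [isSub for ker_val].
HB.instance Definition _ := [Choice of kernel by <:].
HB.instance Definition _ := [SubChoice_isSubLmodule of kernel by <:].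

Lemma kerP (k : kernel) : f (val k) = 0.
Proof. exact/eqP/(ker_valP k). Qed.

Definition ker_incl : {linear kernel -> U} := (val : kernel -> U).

Lemma kerK (x : U) : f x = 0 -> exists k : kernel, val k = x.
Proof. by move/eqP=> fx; exists (Kernel fx). Qed.
End Kernel.

Section KernelLift.
Variables (R : pzRingType) (W U V : lmodType R) (f : {linear U -> V}).
Variables (g : {linear W -> U}) (fg : forall w, f (g w) = 0).

Definition ker_lift (w : W) : kernel f := Kernel (introT eqP (fg w)).
Fact ker_lift_is_linear : linear ker_lift.
Proof. by move=> a u v; apply: val_inj; rewrite /= linearP. Qed.
HB.instance Definition _ :=
  GRing.isLinear.Build R W (kernel f) _ ker_lift ker_lift_is_linear.
End KernelLift.

Definition zimage (U V : zmodType) (f : U -> V) : {pred V} :=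
  fun y => `[< exists x, f x = y >].

Section ZImage.
Variables (U V : zmodType) (f : {additive U -> V}).
Fact zimage_closed : zmod_closed (zimage f).
Proof.
split=> [|u v]; first by apply/asboolP; exists 0; rewrite raddf0.
move=> /asboolP[x <-] /asboolP[y <-]; apply/asboolP.
by exists (x - y); rewrite raddfB.
Qed.
HB.instance Definition _ := GRing.isZmodClosed.Build V (zimage f) zimage_closed.

(** Membership in an image becomes the vanishing of an additive map, the form that
    [tensor_map_kernel] delivers. *)
Lemma zimage_quotient :
  exists (W : zmodType) (p : {additive V -> W}),
    forall y, p y = 0 <-> exists x, f x = y.
Proof.
exists (Quotient.quot (zimage f)), (\pi_(Quotient.quot (zimage f))) => y.
have pi0 := raddf0 \pi_(Quotient.quot (zimage f)).
split=> [/eqP|fy]; first by rewrite -pi0 -Quotient.idealrBE subr0 => /asboolP.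
by apply/eqP; rewrite -pi0 -Quotient.idealrBE subr0; apply/asboolP.
Qed.
End ZImage.

Section Cokernel.
Variables (R : pzRingType) (U V : lmodType R) (f : {linear U -> V}).

Definition im_pred : {pred V} := zimage f.
HB.instance Definition _ := GRing.isZmodClosed.Build V im_pred (zimage_closed f).

Definition coker : Type := Quotient.quot im_pred.
HB.instance Definition _ := GRing.Zmodule.on coker.

Definition coker_proj (y : V) : coker := \pi_(Quotient.quot im_pred) y.

Lemma coker_projP x y :
  coker_proj x = coker_proj y <-> exists u, f u = x - y.
Proof.
split=> [/eqP|].
  by rewrite -Quotient.idealrBE => /asboolP.
by move=> e; apply/eqP; rewrite -Quotient.idealrBE; apply/asboolP.
Qed.

Lemma coker_proj_surj (k : coker) : exists y, coker_proj y = k.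
Proof. by exists (repr (k : Quotient.quot im_pred)); rewrite /coker_proj reprK. Qed.

Lemma coker_projD x y : coker_proj (x + y) = coker_proj x + coker_proj y.
Proof. exact: (raddfD (\pi_(Quotient.quot im_pred))). Qed.

Definition coker_scale (a : R) (k : coker) : coker :=
  coker_proj (a *: repr (k : Quotient.quot im_pred)).

Lemma coker_scaleE a y : coker_scale a (coker_proj y) = coker_proj (a *: y).
Proof.
have /coker_projP[x fx] :
    coker_proj (repr (coker_proj y : Quotient.quot im_pred)) = coker_proj y.
  exact: reprK.
by apply/coker_projP; exists (a *: x); rewrite linearZ_LR fx -scalerBr.
Qed.

Fact coker_scaleA a b v : coker_scale a (coker_scale b v) = coker_scale (a * b) v.
Proof. by have [y <-] := coker_proj_surj v; rewrite !coker_scaleE scalerA. Qed.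
Fact coker_scale1 : left_id 1 coker_scale.
Proof. by move=> v; have [y <-] := coker_proj_surj v; rewrite coker_scaleE scale1r. Qed.
Fact coker_scaleDr : right_distributive coker_scale +%R.
Proof.
move=> a v w; have [y <-] := coker_proj_surj v; have [z <-] := coker_proj_surj w.
by rewrite -coker_projD !coker_scaleE -coker_projD scalerDr.
Qed.
Fact coker_scaleDl v : {morph coker_scale^~ v : a b / a + b}.
Proof.
move=> a b; have [y <-] := coker_proj_surj v.
by rewrite !coker_scaleE -coker_projD scalerDl.
Qed.
HB.instance Definition _ := GRing.Zmodule_isLmodule.Build R coker
  coker_scaleA coker_scale1 coker_scaleDr coker_scaleDl.

Fact coker_proj_is_linear : linear coker_proj.
Proof. by move=> a u v; rewrite coker_projD -coker_scaleE. Qed.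
HB.instance Definition _ :=
  GRing.isLinear.Build R V coker _ coker_proj coker_proj_is_linear.

Lemma coker_proj_eq0 y : coker_proj y = 0 <-> exists x, f x = y.
Proof. by have := coker_projP y 0; rewrite subr0 linear0. Qed.
End Cokernel.

Section Factorization.
Variable R : pzRingType.

Lemma factor_surj (A B N : lmodType R) (p : {linear A -> B}) (f : {linear A -> N}) :
  (forall b, exists a, p a = b) -> (forall a, p a = 0 -> f a = 0) ->
  exists g : {linear B -> N}, forall a, g (p a) = f a.
Proof.
move=> p_surj kf; have [s ps] := choice p_surj; pose g b := f (s b).
have gp a : g (p a) = f a.
  by apply/eqP; rewrite -subr_eq0 -linearB kf // linearB ps subrr.
have gl : linear g.
  move=> k u v; have [a <-] := p_surj u; have [b <-] := p_surj v.
  by rewrite -linearP !gp linearP.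
pose gM := GRing.isLinear.Build R B N _ g gl.
by exists (HB.pack_for {linear B -> N} g gM).
Qed.

Lemma factor_inj (A B N : lmodType R) (j : {linear A -> B}) (f : {linear N -> B}) :
  injective j -> (forall x, exists a, j a = f x) ->
  exists g : {linear N -> A}, forall x, j (g x) = f x.
Proof.
move=> j_inj jf; have [g jg] := choice jf.
have gl : linear g by move=> k u v; apply: j_inj; rewrite linearP !jg linearP.
pose gM := GRing.isLinear.Build R N A _ g gl.
by exists (HB.pack_for {linear N -> A} g gM).
Qed.

(* The image of [d] need not be all of [B]: lift through the pullback of [d] *)
(* along [f], which surjects onto [P].                                       *)
Lemma projective_lift (P A B : lmodType R) (d : {linear A -> B})
    (f : {linear P -> B}) :
  projective P -> (forall x, exists a, d a = f x) ->
  exists g : {linear P -> A}, forall x, d (g x) = f x.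
Proof.
move=> projP df; pose h (z : A * P) := d z.1 - f z.2.
have hl : linear h.
  by move=> k u v; rewrite /h /= !linearP /= scalerDr addrACA.
pose hM := GRing.isLinear.Build R (A * P)%type B _ h hl.
pose hL : {linear (A * P)%type -> B} := HB.pack_for {linear (A * P)%type -> B} h hM.
pose q : {linear kernel hL -> P} := snd \o ker_incl hL.
have [x|g qg] := projP _ _ q idfun.
  have [a da] := df x; have [|k kE] := @kerK _ _ _ hL (a, x).
    by rewrite /= /h /= da subrr.
  by exists k; rewrite /= kE.
exists (fst \o ker_incl hL \o g : {linear P -> A}) => x /=.
have /= := kerP (g x); rewrite /h /= => /eqP; rewrite subr_eq0 => /eqP ->.
by rewrite [X in f X]qg.
Qed.

Lemma projective_exact (P A B D : lmodType R) (u : {linear A -> B})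
    (v : {linear B -> D}) (f : {linear P -> B}) :
  projective P -> exact_at u v -> (forall x, v (f x) = 0) ->
  exists g : {linear P -> A}, forall x, u (g x) = f x.
Proof. by move=> pP uv vf; apply: projective_lift => // x; apply/uv. Qed.

(** The map [f] factors through the cokernel of [u], which exactness embeds in [D]; injectivity of
    [E] extends it from there. *)
Lemma injective_extend (E A B D : lmodType R) (u : {linear A -> B})
    (v : {linear B -> D}) (f : {linear B -> E}) :
  injective_module E -> exact_at u v -> (forall x, f (u x) = 0) ->
  exists g : {linear D -> E}, forall x, g (v x) = f x.
Proof.
move=> injE uv fu.
have [x /coker_proj_eq0[a <-]|f' f'E] :=
  factor_surj (f := f) (@coker_proj_surj _ _ _ u); first exact: fu.
have [x /coker_proj_eq0 /uv // |v' v'E] :=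
  factor_surj (f := v) (@coker_proj_surj _ _ _ u).
have v'_inj : injective v'.
  apply: (raddf_inj (f := v')) => k; have [x <-] := coker_proj_surj k.
  by move: (v'E x) => /= -> /uv ux; apply/coker_proj_eq0.
have [g gv'] := injE _ _ v' f' v'_inj.
by exists g => x; rewrite -v'E gv' f'E.
Qed.
End Factorization.

(** * Diagram chases in short exact sequences of complexes *)

Section Chase.
Variables (X' X X'' Y' Y Y'' Z' Z Z'' : zmodType).
Variables (dX' : {additive X' -> Y'}) (dY' : {additive Y' -> Z'}).
Variables (dX : {additive X -> Y}) (dX'' : {additive X'' -> Y''}).
Variables (dY : {additive Y -> Z}).
Variables (aX : {additive X' -> X}) (pX : {additive X -> X''}).
Variables (aY : {additive Y' -> Y}) (pY : {additive Y -> Y''}).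
Variables (aZ : {additive Z' -> Z}).

Hypothesis adX : forall x, aY (dX' x) = dX (aX x).
Hypothesis pdX : forall x, pY (dX x) = dX'' (pX x).
Hypothesis adY : forall x, aZ (dY' x) = dY (aY x).

(** The boundary of [x] comes from a cycle of the subcomplex, which is there the boundary of some
    [x']; subtracting [aX x'] turns [x] into a cycle over the same element of [X'']. *)
Lemma lift_cycle x :
  (forall x, dY (dX x) = 0) -> (forall x, pX (aX x) = 0) ->
  exact_at aY pY -> injective aZ -> exact_at dX' dY' ->
  dX'' (pX x) = 0 -> exists2 z, dX z = 0 & pX z = pX x.
Proof.
move=> dd pa exY injZ exd e.
have /exY[y' y'E] : pY (dX x) = 0 by rewrite pdX.
have /exd[x' x'E] : dY' y' = 0.
  by apply: injZ; rewrite adY y'E dd raddf0.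
exists (x - aX x'); first by rewrite raddfB -adX x'E y'E subrr.
by rewrite raddfB pa subr0.
Qed.
End Chase.

Section ChaseBoundary.
Variables (W W'' X' X X'' Y' Y Y'' : zmodType).
Variables (dW : {additive W -> X}) (dW'' : {additive W'' -> X''}).
Variables (dX' : {additive X' -> Y'}) (dX : {additive X -> Y}).
Variables (dX'' : {additive X'' -> Y''}).
Variables (pW : {additive W -> W''}).
Variables (aX : {additive X' -> X}) (pX : {additive X -> X''}).
Variables (aY : {additive Y' -> Y}) (pY : {additive Y -> Y''}).

Hypothesis pdW : forall x, pX (dW x) = dW'' (pW x).
Hypothesis adX : forall x, aY (dX' x) = dX (aX x).
Hypothesis pdX : forall x, pY (dX x) = dX'' (pX x).

(** The image of [x] in [X''] is a cycle, hence the boundary of an element that lifts to some [w].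
    Subtracting [dW w] keeps the boundary of [x] and moves [x] into the image of [X']. *)
Lemma lift_boundary x y' :
  (forall x, dX (dW x) = 0) -> (forall y, pY (aY y) = 0) ->
  exact_at aX pX -> injective aY -> (forall w'', exists w, pW w = w'') ->
  exact_at dW'' dX'' ->
  aY y' = dX x -> exists x', dX' x' = y'.
Proof.
move=> dd pa exX injY surjW exd e.
have /exd[w''] : dX'' (pX x) = 0 by rewrite -pdX -e pa.
have [w <-] := surjW w''; rewrite -pdW => wE.
have /exX[x' x'E] : pX (x - dW w) = 0 by rewrite raddfB wE subrr.
by exists x'; apply: injY; rewrite adX x'E raddfB dd subr0.
Qed.
End ChaseBoundary.

Section TensorExact.
Variable R : pzRingType.

(* The kernel of [f (x) g], for surjective [f] and [g], is generated by     *)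
(* [ker f (x) M] and [A (x) ker g]: on [A' (x) M'] a map vanishing on those *)
(* tensors is defined through arbitrary lifts.                              *)
Lemma tensor_map_kernel (A A' : lmodType R^c) (M M' : lmodType R) (V : zmodType)
    (f : {linear A -> A'}) (g : {linear M -> M'}) (h : {additive tensor A M -> V}) :
  (forall b, exists a, f a = b) -> (forall n, exists m, g m = n) ->
  (forall a m, f a = 0 -> h (tens a m) = 0) ->
  (forall a m, g m = 0 -> h (tens a m) = 0) ->
  forall t, tensor_map f g t = 0 -> h t = 0.
Proof.
move=> fs gs hf hg; have [Dl Dr Z] := tens_balanced A M.
have hE a b m n : f a = f b -> g m = g n -> h (tens a m) = h (tens b n).
  move=> fab gmn; rewrite -[a](subrK b) Dl raddfD.
  rewrite hf ?add0r; last by rewrite linearB fab subrr.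
  rewrite -[m](subrK n) Dr raddfD hg ?add0r //.
  by rewrite linearB gmn subrr.
have [s fK] := choice fs; have [r gK] := choice gs.
pose k b n := h (tens (s b) (r n)).
have kb : balanced k.
  split=> [b b' n|b n n'|b x n]; rewrite /k.
  - by rewrite -(raddfD h) -Dl; apply: hE; rewrite // linearD !fK.
  - by rewrite -(raddfD h) -Dr; apply: hE; rewrite // linearD !gK.
  - transitivity (h (tens ((x : R^c) *: s b) (r n))).
      by apply: hE; rewrite // linearZ_LR !fK.
    by rewrite Z; apply: hE; rewrite // linearZ_LR !gK.
pose kM := GRing.isZmodMorphism.Build _ _ (tlift k) (tlift_is_zmod_morphism kb).
pose K := HB.pack_for {additive tensor A' M' -> V} (tlift k) kM.
have KE : K \o tensor_map f g =1 h.
  apply: tensor_ext => a m /=; rewrite tensor_mapE tliftE //.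
  by apply: hE; rewrite ?fK ?gK.
by move=> t ft; rewrite -KE [LHS]/= ft; apply: (raddf0 K).
Qed.

End TensorExact.

(** * Tensor products and resolutions *)

Section TensorMapTheory.
Variable R : pzRingType.

Lemma tensor_map_square (A1 A2 A3 A4 : lmodType R^c) (M1 M2 M3 M4 : lmodType R)
    (f : {linear A2 -> A4}) (f' : {linear A1 -> A2})
    (h : {linear A3 -> A4}) (h' : {linear A1 -> A3})
    (g : {linear M2 -> M4}) (g' : {linear M1 -> M2})
    (k : {linear M3 -> M4}) (k' : {linear M1 -> M3}) :
  (forall a, f (f' a) = h (h' a)) -> (forall m, g (g' m) = k (k' m)) ->
  forall t, tensor_map f g (tensor_map f' g' t) = tensor_map h k (tensor_map h' k' t).
Proof.
move=> fh gk; apply: (tensor_ext (f := tensor_map f g \o tensor_map f' g')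
  (g := tensor_map h k \o tensor_map h' k')) => a m /=.
by rewrite !tensor_mapE fh gk.
Qed.

Lemma tens0l (A : lmodType R^c) (M : lmodType R) (m : M) : tens (0 : A) m = 0.
Proof. by apply: (addIr (tens 0 m)); rewrite -(balancedDl (tens_balanced A M)) !add0r. Qed.

Lemma tens0r (A : lmodType R^c) (M : lmodType R) (a : A) : tens a (0 : M) = 0.
Proof. by apply: (addIr (tens a 0)); rewrite -(balancedDr (tens_balanced A M)) !add0r. Qed.

Lemma tens_suml (A : lmodType R^c) (M : lmodType R) I (r : seq I) (a : I -> A) (m : M) :
  tens (\sum_(i <- r) a i) m = \sum_(i <- r) tens (a i) m.
Proof.
apply: (big_morph (fun x => tens x m)); last exact: tens0l.
by move=> x y; apply: (balancedDl (tens_balanced A M)).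
Qed.

Lemma tensor_map_comp0l (A1 A2 A3 : lmodType R^c) (M1 M2 M3 : lmodType R)
    (f : {linear A2 -> A3}) (f' : {linear A1 -> A2})
    (g : {linear M2 -> M3}) (g' : {linear M1 -> M2}) :
  (forall a, f (f' a) = 0) -> forall t, tensor_map f g (tensor_map f' g' t) = 0.
Proof.
move=> ff; apply: (tensor_ext (f := tensor_map f g \o tensor_map f' g') (g := \0)).
by move=> a m /=; rewrite !tensor_mapE ff tens0l.
Qed.

Lemma tensor_map_comp0r (A1 A2 A3 : lmodType R^c) (M1 M2 M3 : lmodType R)
    (f : {linear A2 -> A3}) (f' : {linear A1 -> A2})
    (g : {linear M2 -> M3}) (g' : {linear M1 -> M2}) :
  (forall a, g (g' a) = 0) -> forall t, tensor_map f g (tensor_map f' g' t) = 0.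
Proof.
move=> gg; apply: (tensor_ext (f := tensor_map f g \o tensor_map f' g') (g := \0)).
by move=> a m /=; rewrite !tensor_mapE gg tens0r.
Qed.

Lemma tensor_map_surj (A A' : lmodType R^c) (M M' : lmodType R)
    (f : {linear A -> A'}) (g : {linear M -> M'}) :
  (forall b, exists a, f a = b) -> (forall n, exists m, g m = n) ->
  forall t, exists u, tensor_map f g u = t.
Proof.
move=> fs gs; apply: tensor_ind; first by exists 0; rewrite raddf0.
  by move=> x y [u <-] [v <-]; exists (u - v); rewrite raddfB.
move=> b n; have [a <-] := fs b; have [m <-] := gs n.
by exists (tens a m); rewrite /= tensor_mapE.
Qed.

Lemma tensor_right_exactl (A B D : lmodType R^c) (M : lmodType R)
    (u : {linear A -> B}) (v : {linear B -> D}) :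
  exact_at u v -> (forall d, exists b, v b = d) ->
  exact_at (tensor_map u (idfun : {linear M -> M}))
           (tensor_map v (idfun : {linear M -> M})).
Proof.
move=> uv vs t; split=> [|[s <-]]; last first.
  by apply: tensor_map_comp0l => a; apply/uv; exists a.
have [W [p pE]] := zimage_quotient (tensor_map u (idfun : {linear M -> M})).
move=> vt; apply/pE; apply: tensor_map_kernel vt => //; first by move=> m; exists m.
  by move=> b m /uv[a <-]; apply/pE; exists (tens a m); rewrite /= tensor_mapE.
by move=> b m /= ->; rewrite tens0r raddf0.
Qed.

Lemma tensor_right_exactr (A : lmodType R^c) (M N L : lmodType R)
    (u : {linear M -> N}) (v : {linear N -> L}) :
  exact_at u v -> (forall d, exists b, v b = d) ->
  exact_at (tensor_map (idfun : {linear A -> A}) u)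
           (tensor_map (idfun : {linear A -> A}) v).
Proof.
move=> uv vs t; split=> [|[s <-]]; last first.
  by apply: tensor_map_comp0r => a; apply/uv; exists a.
have [W [p pE]] := zimage_quotient (tensor_map (idfun : {linear A -> A}) u).
move=> vt; apply/pE; apply: tensor_map_kernel vt => //; first by move=> m; exists m.
  by move=> b m /= ->; rewrite tens0l raddf0.
by move=> a n /uv[m <-]; apply/pE; exists (tens a m); rewrite /= tensor_mapE.
Qed.

End TensorMapTheory.

(** Dependent choice with an invariant: [Q] is the condition under which degree [i] can be
    continued. Chain maps and homotopies are built this way. *)
Lemma dependent_sequence (T : nat -> Type) (Q : forall i, T i -> Prop)
    (E : forall i, T i -> T i.+1 -> Prop) (x0 : T 0%N) :
  Q 0%N x0 -> (forall i x, Q i x -> exists2 y, Q i.+1 y & E i x y) ->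
  exists x : forall i, T i, x 0%N = x0 /\ forall i, E i (x i) (x i.+1).
Proof.
move=> Q0 step; pose U i := {x : T i | Q i x}.
have next i (x : U i) : {y : U i.+1 | E i (sval x) (sval y)}.
  by apply: cid; have [y Qy Exy] := step i _ (svalP x); exists (exist _ y Qy).
pose s := nat_rect U (exist _ x0 Q0) (fun i x => sval (next i x)).
by exists (fun i => sval (s i)); split=> // i; exact: svalP (next i (s i)).
Qed.

(** * Comparison of projective resolutions; Ext and Tor on augmented complexes *)

Section Augmented.
Variable R : pzRingType.

(* A resolution, augmented by [M] in degree [0]: [P i] sits in degree [i.+1]. *)
Definition aobj (M : lmodType R) (P : resolution M) (i : nat) : lmodType R :=
  if i is j.+1 then P j else M.

Definition adiff (M : lmodType R) (P : resolution M) (i : nat) :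
    {linear aobj P i.+1 -> aobj P i} :=
  match i with 0%N => res_aug P | j.+1 => res_diff P j end.

Definition projective_resolution (M : lmodType R) (P : resolution M) : Prop :=
  forall i, projective (P i).

Lemma adiff_surj (M : lmodType R) (P : resolution M) x : exists y, adiff P 0 y = x.
Proof. exact: res_aug_surj. Qed.
Arguments adiff_surj [M] P x.

Lemma adiff_exact (M : lmodType R) (P : resolution M) i :
  exact_at (adiff P i.+1) (adiff P i).
Proof. by case: i => [|i]; [apply: res_exact0 | apply: res_exact]. Qed.

Arguments adiff_exact [M] P i _.

Lemma adiffK (M : lmodType R) (P : resolution M) i x :
  adiff P i (adiff P i.+1 x) = 0.
Proof. by apply/(adiff_exact P i); exists x. Qed.
Arguments adiffK [M] P i x.

Lemma comparison_map (M : lmodType R) (P Q : resolution M) :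
  projective_resolution P ->
  exists f : forall i, {linear aobj P i -> aobj Q i},
    f 0%N =1 id /\ forall i x, adiff Q i (f i.+1 x) = f i (adiff P i x).
Proof.
move=> projP.
(* The invariant says that the map can be lifted one degree further. *)
pose good i (f : {linear aobj P i -> aobj Q i}) :=
  forall x, exists y, adiff Q i y = f (adiff P i x).
have [||f [f0 fE]] := dependent_sequence (Q := good) (x0 := idfun)
  (E := fun i f g => forall x, adiff Q i (g x) = f (adiff P i x)).
- by move=> x; apply: adiff_surj.
- move=> i f fP.
  have [g gE] := projective_lift (d := adiff Q i) (f := f \o adiff P i) (projP i) fP.
  exists g => // x; apply/(adiff_exact Q i).
  by rewrite gE /= adiffK linear0.
- by exists f; split=> [x|//]; rewrite f0.
Qed.

(** Here [h] stands for the difference of two lifts of one map; it vanishes on [M], so the homotopy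
    can start at zero. *)
Lemma comparison_homotopy (M : lmodType R) (Q : resolution M)
    (h : forall i, {linear aobj Q i -> aobj Q i}) :
  projective_resolution Q -> h 0%N =1 (fun=> 0) ->
  (forall i x, adiff Q i (h i.+1 x) = h i (adiff Q i x)) ->
  exists s : forall i, {linear aobj Q i -> aobj Q i.+1},
    forall i x, h i.+1 x = adiff Q i.+1 (s i.+1 x) + s i (adiff Q i x).
Proof.
move=> projQ h0 hd.
pose good i (s : {linear aobj Q i -> aobj Q i.+1}) :=
  forall x, adiff Q i (h i.+1 x - s (adiff Q i x)) = 0.
have [||s [_ sE]] := dependent_sequence (Q := good) (x0 := \0)
  (E := fun i s s' => forall x, h i.+1 x = adiff Q i.+1 (s' x) + s (adiff Q i x)).
- by move=> x; rewrite /= subr0 hd h0.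
- move=> i s sP.
  have [|s' s'E] := projective_exact (f := h i.+1 \- (s \o adiff Q i))
    (projQ i) (adiff_exact Q i).
    by move=> x; apply: sP.
  exists s' => x; last by rewrite s'E /= subrK.
  by rewrite linearB hd s'E /= adiffK linear0 subr0 subrr.
- by exists s.
Qed.

(** Only the homotopy on [Q] is recorded: it suffices for carrying acyclicity from [P] to [Q]. *)
Lemma comparison (M : lmodType R) (P Q : resolution M) :
  projective_resolution P -> projective_resolution Q ->
  exists (f : forall i, {linear aobj Q i -> aobj P i})
         (g : forall i, {linear aobj P i -> aobj Q i})
         (s : forall i, {linear aobj Q i -> aobj Q i.+1}),
  [/\ forall i x, adiff P i (f i.+1 x) = f i (adiff Q i x),
      forall i x, adiff Q i (g i.+1 x) = g i (adiff P i x)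
    & forall i x, x = g i.+1 (f i.+1 x) +
                      (adiff Q i.+1 (s i.+1 x) + s i (adiff Q i x))].
Proof.
move=> projP projQ.
have [f [f0 fd]] := comparison_map P projQ.
have [g [g0 gd]] := comparison_map Q projP.
have [x|i x|s sE] := comparison_homotopy (h := fun i => idfun \- (g i \o f i)) projQ.
- by rewrite /= f0 g0 subrr.
- by rewrite /= linearB gd fd.
- by exists f, g, s; split=> // i x; rewrite -sE /= addrC subrK.
Qed.

(** Index [i.+1] is the vanishing of Ext in degree [i.+1]. Index 0 is left exactness of Hom, always
    true by [ext_acyclic0]; including it lets the chases treat all degrees alike. *)
Definition ext_acyclic (M : lmodType R) (P : resolution M) (N : lmodType R) : Prop :=
  forall i, exact_at (hom_pre (N := N) (adiff P i)) (hom_pre (N := N) (adiff P i.+1)).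

Lemma ext_acyclic0 (M : lmodType R) (P : resolution M) (N : lmodType R) :
  exact_at (hom_pre (N := N) (adiff P 0)) (hom_pre (N := N) (adiff P 1)).
Proof.
move=> f; split=> [fd|[g <-]]; last first.
  by apply: homP => x /=; rewrite adiffK linear0.
have [x /(adiff_exact P 0)[y <-]|g gE] := factor_surj (f := f) (adiff_surj P).
  by move/(congr1 (fun h : linhom _ _ => h y)): fd.
by exists g; apply: homP.
Qed.

Lemma Ext_eq0_acyclic (M : lmodType R) (P : resolution M) (N : lmodType R) :
  projective_resolution P ->
  (forall i, (1 <= i)%N -> Ext_eq0 i M N) -> ext_acyclic P N.
Proof.
move=> projP extN [|i]; first exact: ext_acyclic0.
exact: (extN i.+1 _ P projP).
Qed.

Lemma acyclic_Ext_eq0 (M : lmodType R) (P : resolution M) (N : lmodType R) :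
  projective_resolution P -> ext_acyclic P N ->
  forall i, (1 <= i)%N -> Ext_eq0 i M N.
Proof.
move=> projP extP [//|i] _ Q projQ.
have [f [g [s [fd gd fgs]]]] := comparison projP projQ.
rewrite -[res_diff Q i]/(adiff Q i.+1) -[res_diff Q i.+1]/(adiff Q i.+2) => k.
split=> [kd|[h <-]]; last by apply: homP => x /=; rewrite (adiffK Q i.+1) linear0.
have {}kd x : k (adiff Q i.+2 x) = 0
  by move/(congr1 (fun h : linhom _ _ => h x)): kd.
have /(extP i.+1)[h hE] : hom_pre (adiff P i.+2) (k \o g i.+2 : {linear _ -> _}) = 0.
  by apply: homP => x /=; rewrite -gd kd.
(* The witness is read off from [k = k g f + k (d s + s d)], using [k d = 0] and [k g = h d]. *)
exists (h \o f i.+1 \+ (k \o s i.+1) : {linear _ -> _}); apply: homP => x /=.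
rewrite [in RHS](fgs _ x) !linearD kd add0r -fd; congr (_ + _).
by move/(congr1 (fun h : linhom _ _ => h (f i.+2 x))): hE.
Qed.
End Augmented.

Arguments adiff_surj [R M] P x.
Arguments adiff_exact [R M] P i _.
Arguments adiffK [R M] P i x.

Section AugmentedTor.
Variables (R : pzRingType) (A : lmodType R^c).
Implicit Types (P Q : resolution A) (M : lmodType R).

Definition tdiff P M i : {additive tensor (aobj P i.+1) M -> tensor (aobj P i) M} :=
  tensor_map (adiff P i) (idfun : {linear M -> M}).

(** Index 0 is right exactness of the tensor product; index [i.+1] is the vanishing of Tor in degree
    [i.+1]. *)
Definition tor_acyclic P M : Prop := forall i, exact_at (tdiff P M i.+1) (tdiff P M i).

Lemma tdiffK P M i t : tdiff P M i (tdiff P M i.+1 t) = 0.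
Proof. by apply: tensor_map_comp0l => a; apply: adiffK. Qed.
Arguments tdiffK : clear implicits.

Lemma tdiff_surj P M t : exists u, tdiff P M 0 u = t.
Proof. by apply: tensor_map_surj => x; [apply: adiff_surj | exists x]. Qed.

Lemma tor_acyclic0 P M : exact_at (tdiff P M 1) (tdiff P M 0).
Proof. by apply: tensor_right_exactl; [apply: adiff_exact | apply: adiff_surj]. Qed.

Lemma acyclic_Tor_eq0 P M :
  projective_resolution P -> tor_acyclic P M ->
  forall i, (1 <= i)%N -> Tor_eq0 i A M.
Proof.
move=> projP torP [//|i] _ Q projQ.
have [f [g [s [fd gd fgs]]]] := comparison projP projQ.
move=> d t; rewrite -[d i]/(tdiff Q M i.+1 : _ -> _).
rewrite -[d i.+1]/(tdiff Q M i.+2 : _ -> _).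
split=> [dt|[u <-]]; last exact: (tdiffK Q M i.+1).
pose tm (A1 A2 : lmodType R^c) (h : {linear A1 -> A2}) :=
  tensor_map h (idfun : {linear M -> M}).
have /(torP i.+1)[u uE] : tdiff P M i.+1 (tm _ _ (f i.+2) t) = 0.
  transitivity (tm _ _ (f i.+1) (tdiff Q M i.+1 t)); last by rewrite dt /tm raddf0.
  by apply: tensor_map_square => //; apply: fd.
exists (tm _ _ (g i.+3) u + tm _ _ (s i.+2) t).
(* The homotopy identity of [comparison], tensored with [M]. *)
have tE : t = tm _ _ (g i.+2) (tm _ _ (f i.+2) t) +
    (tdiff Q M i.+2 (tm _ _ (s i.+2) t) + tm _ _ (s i.+1) (tdiff Q M i.+1 t)).
  move: t {dt uE}; apply: (tensor_ext (f := idfun)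
   (g := (tensor_map (g i.+2) (idfun : {linear M -> M})
         \o tensor_map (f i.+2) (idfun : {linear M -> M})) \+
        ((tdiff Q M i.+2 \o tensor_map (s i.+2) (idfun : {linear M -> M})) \+
         (tensor_map (s i.+1) (idfun : {linear M -> M}) \o tdiff Q M i.+1)))).
  move=> a m /=; rewrite /tdiff !tensor_mapE /= -!(balancedDl (tens_balanced _ M)).
  by rewrite -fgs.
rewrite [RHS]tE dt raddfD; congr (_ + _); last by rewrite /tm raddf0 addr0.
rewrite -uE; apply: tensor_map_square => //; exact: gd.
Qed.
End AugmentedTor.

Arguments tdiffK [R A] P M i t.
Arguments tdiff_surj [R A] P [M] t.

Definition dual_basis (R : pzRingType) (P : lmodType R) n
    (e : 'I_n -> P) (phi : {linear P -> 'rV[R]_n}) : Prop :=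
  forall x, x = \sum_(i < n) phi x 0 i *: e i.

(** The coordinates come from a splitting of the surjection from the free module on the
    generators. *)
Lemma projective_dual_basis (R : pzRingType) (P : lmodType R) :
  projective P -> finitely_generated P ->
  exists (n : nat) (e : 'I_n -> P) (phi : {linear P -> 'rV[R]_n}), dual_basis e phi.
Proof.
move=> projP [n [e eP]].
pose p (a : 'rV[R]_n) : P := \sum_(i < n) a 0 i *: e i.
have pl : linear p.
  move=> k u v; rewrite /p scaler_sumr -big_split /=; apply: eq_bigr => i _.
  by rewrite !mxE scalerDl scalerA.
pose pM := GRing.isLinear.Build R 'rV[R]_n P _ p pl.
pose pL : {linear 'rV[R]_n -> P} := HB.pack_for {linear 'rV[R]_n -> P} p pM.
have [x|phi phiE] := projP _ _ pL idfun.
  have [a ->] := eP x; exists (\row_i a i).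
  by apply: eq_bigr => i _; rewrite mxE.
by exists n, e, phi => x; rewrite -[LHS]phiE.
Qed.

(** * Hom modules and evaluation maps *)

Section HomFunctor.
Variable R : pzRingType.

Fact hom_pre_is_zmod_morphism (U U' N : lmodType R) (d : {linear U' -> U}) :
  zmod_morphism (hom_pre (N := N) d).
Proof. by move=> f g; apply: homP. Qed.
HB.instance Definition _ (U U' N : lmodType R) (d : {linear U' -> U}) :=
  GRing.isZmodMorphism.Build (linhom U N) (linhom U' N) (hom_pre d)
    (hom_pre_is_zmod_morphism (N := N) d).

Definition hom_post (U N N' : lmodType R) (g : {linear N -> N'}) (f : linhom U N) :
    linhom U N' := (g \o f : {linear U -> N'}).

Fact hom_post_is_zmod_morphism (U N N' : lmodType R) (g : {linear N -> N'}) :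
  zmod_morphism (hom_post (U := U) g).
Proof. by move=> f h; apply: homP => x /=; rewrite linearB. Qed.
HB.instance Definition _ (U N N' : lmodType R) (g : {linear N -> N'}) :=
  GRing.isZmodMorphism.Build (linhom U N) (linhom U N') (hom_post g)
    (hom_post_is_zmod_morphism (U := U) g).

Lemma homE (U V : lmodType R) (f g : linhom U V) : f = g -> f =1 g.
Proof. by move->. Qed.
End HomFunctor.

(* Hom_S(X, C) as a right R-module. *)
Definition rhom (S R : pzRingType) (C : bimodType S R) (X : lmodType S) : Type :=
  linhom X C.

Section RightHom.
Variables (S R : pzRingType) (C : bimodType S R) (X : lmodType S).

HB.instance Definition _ := GRing.Zmodule.on (rhom C X).

Section Scale.
Variables (r : R^c) (f : rhom C X).
Let g (x : X) : C := rscale ((f : linhom X C) x) (r : R).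
Fact rhom_scale_is_linear : linear g.
Proof. by move=> s x y; rewrite /g linearP rscaleDl rscaleAl. Qed.
HB.instance Definition _ := GRing.isLinear.Build S X C _ g rhom_scale_is_linear.
Definition rhom_scale : rhom C X := (g : {linear X -> C}).
End Scale.

Fact rhom_scaleA a b f : rhom_scale a (rhom_scale b f) = rhom_scale (a * b) f.
Proof. by apply: homP => x; apply: rscaleA. Qed.
Fact rhom_scale1 : left_id 1 rhom_scale.
Proof. by move=> f; apply: homP => x; apply: rscale1. Qed.
Fact rhom_scaleDr : right_distributive rhom_scale +%R.
Proof. by move=> r f g; apply: homP => x; apply: rscaleDl. Qed.
Fact rhom_scaleDl f : {morph rhom_scale^~ f : a b / a + b}.
Proof. by move=> a b; apply: homP => x; apply: rscaleDr. Qed.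

HB.instance Definition _ := GRing.Zmodule_isLmodule.Build R^c (rhom C X)
  rhom_scaleA rhom_scale1 rhom_scaleDr rhom_scaleDl.
End RightHom.

(* Hom_{R^op}(X, C) as a left S-module. *)
Definition lhom (S R : pzRingType) (C : bimodType S R) (X : lmodType R^c) : Type :=
  linhom X (rmod C).

Section LeftHom.
Variables (S R : pzRingType) (C : bimodType S R) (X : lmodType R^c).

HB.instance Definition _ := GRing.Zmodule.on (lhom C X).

Definition lhom_scale (s : S) (f : lhom C X) : lhom C X :=
  hom_post (homothety_l C s) f.

Fact lhom_scaleA a b f : lhom_scale a (lhom_scale b f) = lhom_scale (a * b) f.
Proof. by apply: homP => x; apply: (scalerA a b (_ : C)). Qed.
Fact lhom_scale1 : left_id 1 lhom_scale.
Proof. by move=> f; apply: homP => x; apply: (scale1r (_ : C)). Qed.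
Fact lhom_scaleDr : right_distributive lhom_scale +%R.
Proof. by move=> s f g; apply: homP => x; apply: (scalerDr s (_ : C)). Qed.
Fact lhom_scaleDl f : {morph lhom_scale^~ f : a b / a + b}.
Proof. by move=> a b; apply: homP => x; apply: (scalerDl (_ : C)). Qed.

HB.instance Definition _ := GRing.Zmodule_isLmodule.Build S (lhom C X)
  lhom_scaleA lhom_scale1 lhom_scaleDr lhom_scaleDl.
End LeftHom.

Section ModuleMaps.
Variables (S R : pzRingType) (C : bimodType S R).

Section RightPre.
Variables (X Y : lmodType S) (d : {linear X -> Y}).
Definition rhom_pre : rhom C Y -> rhom C X := hom_pre d.
Fact rhom_pre_is_linear : linear rhom_pre.
Proof. by move=> r f g; apply: homP. Qed.
HB.instance Definition _ :=
  GRing.isLinear.Build R^c (rhom C Y) (rhom C X) _ rhom_pre rhom_pre_is_linear.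
End RightPre.

Section LeftPre.
Variables (X Y : lmodType R^c) (d : {linear X -> Y}).
Definition lhom_pre : lhom C Y -> lhom C X := hom_pre d.
Fact lhom_pre_is_linear : linear lhom_pre.
Proof. by move=> r f g; apply: homP. Qed.
HB.instance Definition _ :=
  GRing.isLinear.Build S (lhom C Y) (lhom C X) _ lhom_pre lhom_pre_is_linear.
End LeftPre.

Section BimodulePost.
Variables (N N' : lmodType S) (g : {linear N -> N'}).
Definition bhom_post : bhom C N -> bhom C N' := hom_post g.
Fact bhom_post_is_linear : linear bhom_post.
Proof. by move=> r f h; apply: homP => c /=; rewrite linearD. Qed.
HB.instance Definition _ :=
  GRing.isLinear.Build R (bhom C N) (bhom C N') _ bhom_post bhom_post_is_linear.
End BimodulePost.

Section BimoduleTensorMap.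
Variables (M M' : lmodType R) (g : {linear M -> M'}).
Definition btensor_map : btensor C M -> btensor C M' :=
  tensor_map (idfun : {linear rmod C -> rmod C}) g.
HB.instance Definition _ := GRing.Additive.on btensor_map.
Fact btensor_map_is_scalable : scalable btensor_map.
Proof.
move=> s; apply: (tensor_ext (f := btensor_map \o btensor_scale s)
  (g := btensor_scale s \o btensor_map)) => c m /=.
by rewrite /btensor_map !(btensor_scaleE, tensor_mapE).
Qed.
HB.instance Definition _ :=
  GRing.isScalable.Build S (btensor C M) (btensor C M') _ btensor_map
    btensor_map_is_scalable.
Lemma btensor_mapE c m : btensor_map (btens c m) = btens c (g m).
Proof. exact: tensor_mapE. Qed.
End BimoduleTensorMap.

Lemma mu_natural (M M' : lmodType R) (g : {linear M -> M'}) (m : M) :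
  mu C (g m) = bhom_post (btensor_map g) (mu C m).
Proof. by apply: homP => c; rewrite /= btensor_mapE. Qed.

Lemma nu_natural (N N' : lmodType S) (g : {linear N -> N'}) (t : btensor C (bhom C N)) :
  nu (btensor_map (bhom_post g) t) = g (nu t).
Proof.
move: t; apply: (tensor_ext (f := @nu _ _ C N' \o btensor_map (bhom_post g))
  (g := (g : {additive N -> N'}) \o @nu _ _ C N)) => c f /=.
by rewrite [X in nu X]btensor_mapE !nuE.
Qed.
End ModuleMaps.

Arguments rhom_pre [S R] C [X Y] d.
Arguments lhom_pre [S R] C [X Y] d.
Arguments bhom_post [S R] C [N N'] g.
Arguments btensor_map [S R] C [M M'] g.

(** * Evaluation maps on modules with a finite dual basis *)

Section TensorEvaluation.
Variables (S R : pzRingType) (C : bimodType S R) (F : lmodType R).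

Let thom_at (X : lmodType S) (f : rhom C X) (m : F) : linhom X (btensor C F) :=
  hom_pre f (mu C m).

Fact thom_balanced X : balanced (thom_at (X := X)).
Proof.
have [Dl Dr Z] := tens_balanced (rmod C) F.
split=> *; apply: homP => x; [exact: Dl | exact: Dr | exact: Z].
Qed.

Definition thom X : tensor (rhom C X) F -> linhom X (btensor C F) :=
  tlift (thom_at (X := X)).
HB.instance Definition _ X := GRing.isZmodMorphism.Build _ _ (thom (X := X))
  (tlift_is_zmod_morphism (thom_balanced X)).

Lemma thomE X (f : rhom C X) m x :
  thom (tens f m) x = btens ((f : linhom X C) x) m.
Proof. by rewrite /thom (tliftE (thom_balanced X)). Qed.

Lemma thom_natural (X Y : lmodType S) (d : {linear X -> Y}) (t : tensor (rhom C Y) F) :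
  thom (tensor_map (rhom_pre C d) (idfun : {linear F -> F}) t) = hom_pre d (thom t).
Proof.
move: t; apply: (tensor_ext
  (f := @thom X \o tensor_map (rhom_pre C d) (idfun : {linear F -> F}))
  (g := hom_pre d \o @thom Y)) => f m /=.
by rewrite tensor_mapE; apply: homP => x /=; rewrite !thomE.
Qed.

Section DualBasis.
Variables (X : lmodType S) (n : nat) (e : 'I_n -> X) (phi : {linear X -> 'rV[S]_n}).
Hypothesis eE : dual_basis e phi.

Section Coevaluation.
Variable i : 'I_n.
Section At.
Variable c : rmod C.
Let h (x : X) : C := phi x 0 i *: (c : C).
Fact rcoev_at_is_linear : linear h.
Proof. by move=> s x y; rewrite /h linearP !mxE scalerDl scalerA. Qed.
HB.instance Definition _ := GRing.isLinear.Build S X C _ h rcoev_at_is_linear.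
Definition rcoev : rhom C X := (h : {linear X -> C}).
End At.
Fact rcoev_is_linear : linear rcoev.
Proof.
move=> r c c'; apply: homP => x.
by rewrite /= [LHS](scalerDr _ (_ : C)) -rscaleAl.
Qed.
HB.instance Definition _ :=
  GRing.isLinear.Build R^c (rmod C) (rhom C X) _ rcoev rcoev_is_linear.
End Coevaluation.

Let thom_inv (h : linhom X (btensor C F)) : tensor (rhom C X) F :=
  \sum_(i < n) tensor_map (rcoev i) (idfun : {linear F -> F}) (h (e i)).

Lemma thom_rcoev i (u : btensor C F) x :
  thom (tensor_map (rcoev i) (idfun : {linear F -> F}) u) x = phi x 0 i *: u.
Proof.
pose ev (h : linhom X (btensor C F)) := h x.
have evB : zmod_morphism ev by [].
pose evM := GRing.isZmodMorphism.Build _ _ ev evB.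
pose evA : {additive linhom X (btensor C F) -> btensor C F} :=
  HB.pack_for {additive linhom X (btensor C F) -> btensor C F} ev evM.
move: u; apply: (tensor_ext
  (f := evA \o (@thom X \o tensor_map (rcoev i) (idfun : {linear F -> F})))
  (g := btensor_scale (phi x 0 i))) => c m /=.
by rewrite tensor_mapE /ev thomE btensor_scaleE.
Qed.

Lemma sum_homE (U V : lmodType S) I (r : seq I) (h : I -> linhom U V) x :
  (\sum_(i <- r) h i : linhom U V) x = \sum_(i <- r) h i x.
Proof. by elim/big_rec2: _ => //= i y1 y2 _ <-. Qed.

(** Each [f] is the sum of the [rcoev i (f (e i))], so the inverse spreads the values [h (e i)] over
    the coevaluations. These values need not be pure tensors, hence the use of [tensor_map] in
    [thom_inv]. *)
Lemma thom_bij : bijective (@thom X).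
Proof.
exists thom_inv => [|h].
  have invB : zmod_morphism thom_inv.
    by move=> f g; rewrite /thom_inv -sumrB; apply: eq_bigr => i _; rewrite -raddfB.
  pose invM := GRing.isZmodMorphism.Build _ _ thom_inv invB.
  pose invA := HB.pack_for
    {additive linhom X (btensor C F) -> tensor (rhom C X) F} thom_inv invM.
  apply: (tensor_ext (f := invA \o @thom X) (g := idfun)) => f m /=.
  rewrite /thom_inv; under eq_bigr => i _ do
    rewrite thomE [X in tensor_map _ _ X]/btens tensor_mapE /=.
  rewrite [in RHS](_ : f = \sum_(i < n) rcoev i ((f : linhom X C) (e i))); last first.
    apply: homP => x; rewrite [RHS]sum_homE {1}(eE x) linear_sum.
    by apply: eq_bigr => i _; rewrite linearZ.
  by rewrite tens_suml.
apply: homP => x; rewrite /thom_inv raddf_sum sum_homE [in RHS](eE x) linear_sum.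
by apply: eq_bigr => i _; rewrite thom_rcoev linearZ.
Qed.
End DualBasis.
End TensorEvaluation.

Section ProjectiveTensor.
Variables (R : pzRingType) (X : lmodType R^c) (n : nat).
Variables (e : 'I_n -> X) (phi : {linear X -> 'rV[R^c]_n}).
Hypothesis eE : dual_basis e phi.

Section Coordinate.
Variables (M : lmodType R) (i : 'I_n).
Let k (x : X) (m : M) : M := (phi x 0 i : R) *: m.

Fact coordinate_balanced : balanced k.
Proof.
split=> [x y m|x m m'|x r m]; rewrite /k.
- by rewrite linearD mxE [LHS]scalerDl.
- by rewrite scalerDr.
- by rewrite linearZ_LR mxE scalerA.
Qed.

Definition coordinate : tensor X M -> M := tlift k.
HB.instance Definition _ := GRing.isZmodMorphism.Build _ _ coordinate
  (tlift_is_zmod_morphism coordinate_balanced).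

Lemma coordinateE x m : coordinate (tens x m) = (phi x 0 i : R) *: m.
Proof. exact: tliftE coordinate_balanced _ _. Qed.
End Coordinate.

Lemma coordinate_natural (M M' : lmodType R) (g : {linear M -> M'}) i t :
  coordinate i (tensor_map (idfun : {linear X -> X}) g t) = g (coordinate i t).
Proof.
move: t; apply: (tensor_ext
  (f := coordinate (M := M') i \o tensor_map (idfun : {linear X -> X}) g)
  (g := (g : {additive M -> M'}) \o coordinate (M := M) i)) => x m /=.
by rewrite tensor_mapE !coordinateE linearZ.
Qed.

(** The dual basis rebuilds [t] from its coordinates, so X (x) M embeds in M^n, naturally in [M]. *)
Lemma coordinate_eq0 (M : lmodType R) (t : tensor X M) :
  (forall i, coordinate i t = 0) -> t = 0.
Proof.
have [Dl Dr Z] := tens_balanced X M.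
pose rebuild (t : tensor X M) : tensor X M := \sum_i tens (e i) (coordinate i t).
have rB : zmod_morphism rebuild.
  move=> u v; rewrite /rebuild -sumrB; apply: eq_bigr => i _.
  apply/eqP; rewrite eq_sym subr_eq -Dr; apply/eqP; congr tens.
  by rewrite -raddfD subrK.
pose rM := GRing.isZmodMorphism.Build _ _ rebuild rB.
pose rA := HB.pack_for {additive tensor X M -> tensor X M} rebuild rM.
have rE : idfun =1 rA.
  apply: tensor_ext => x m; rewrite /= /rebuild.
  under eq_bigr => i _ do rewrite coordinateE -Z.
  by rewrite -tens_suml -(eE x).
move=> t0; rewrite [t]rE /= /rebuild big1 // => i _.
by rewrite t0 tens0r.
Qed.

Lemma projective_tensor_inj (M M' : lmodType R) (g : {linear M -> M'}) :
  injective g -> injective (tensor_map (idfun : {linear X -> X}) g).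
Proof.
move=> g_inj; apply: raddf_inj => t gt; apply: coordinate_eq0 => i.
by apply: g_inj; rewrite -coordinate_natural gt raddf0 linear0.
Qed.
End ProjectiveTensor.

Section TensorHomEvaluation.
Variables (S R : pzRingType) (C : bimodType S R) (E : lmodType S).

Section At.
Variables (X : lmodType R^c) (x : X) (f : bhom C E).
Let h (g : lhom C X) : E := (f : linhom C E) ((g : linhom X (rmod C)) x).
Fact homt_at_is_linear : linear h.
Proof. by move=> s g g'; rewrite /h -linearP. Qed.
HB.instance Definition _ := GRing.isLinear.Build S (lhom C X) E _ h homt_at_is_linear.
Definition homt_at : linhom (lhom C X) E := (h : {linear lhom C X -> E}).
End At.

Fact homt_balanced X : balanced (homt_at (X := X)).
Proof.
split=> *; apply: homP => g //=; first by rewrite linearD [LHS]linearD.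
by rewrite linearZ_LR.
Qed.

Definition homt X : tensor X (bhom C E) -> linhom (lhom C X) E :=
  tlift (homt_at (X := X)).
HB.instance Definition _ X := GRing.isZmodMorphism.Build _ _ (homt (X := X))
  (tlift_is_zmod_morphism (homt_balanced X)).

Lemma homtE (X : lmodType R^c) (x : X) (f : bhom C E) g :
  homt (tens x f) g = (f : linhom C E) ((g : linhom X (rmod C)) x).
Proof. by rewrite /homt (tliftE (homt_balanced X)). Qed.

Lemma homt_natural (X Y : lmodType R^c) (d : {linear X -> Y}) (t : tensor X (bhom C E)) :
  homt (tensor_map d (idfun : {linear bhom C E -> bhom C E}) t) =
  hom_pre (lhom_pre C d) (homt t).
Proof.
move: t; apply: (tensor_ext
  (f := @homt Y \o tensor_map d (idfun : {linear bhom C E -> bhom C E}))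
  (g := hom_pre (lhom_pre C d) \o @homt X)) => x f /=.
by rewrite tensor_mapE; apply: homP => g /=; rewrite !homtE.
Qed.

Section DualBasis.
Variables (X : lmodType R^c) (n : nat) (e : 'I_n -> X).
Variable (phi : {linear X -> 'rV[R^c]_n}).
Hypothesis eE : dual_basis e phi.

Section Coevaluation.
Variable i : 'I_n.
Section At.
Variable c : C.
Let h (x : X) : rmod C := phi x 0 i *: (c : rmod C).
Fact lcoev_at_is_linear : linear h.
Proof. by move=> r x y; rewrite /h linearP !mxE scalerDl scalerA. Qed.
HB.instance Definition _ := GRing.isLinear.Build R^c X (rmod C) _ h lcoev_at_is_linear.
Definition lcoev : lhom C X := (h : {linear X -> rmod C}).
End At.
Fact lcoev_is_linear : linear lcoev.
Proof.
move=> s c c'; apply: homP => x; rewrite /= [LHS]scalerDr; congr (_ + _).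
by rewrite /homothety_l; apply: esym; apply: rscaleAl.
Qed.
HB.instance Definition _ := GRing.isLinear.Build S C (lhom C X) _ lcoev lcoev_is_linear.
End Coevaluation.

Let homt_inv (h : linhom (lhom C X) E) : tensor X (bhom C E) :=
  \sum_(i < n) tens (e i) (hom_pre (lcoev i) h : bhom C E).

(** Each [g] is the sum of the [lcoev i (g (e i))], so a functional [h] is determined by its
    composites with the [lcoev i], which are maps from C to E. *)
Lemma homt_bij : bijective (@homt X).
Proof.
have [Dl Dr Z] := tens_balanced X (bhom C E).
exists homt_inv => [|h].
  have invB : zmod_morphism homt_inv.
    move=> f g; rewrite /homt_inv -sumrB; apply: eq_bigr => i _.
    apply/eqP; rewrite eq_sym subr_eq -Dr; apply/eqP; congr tens.
    by rewrite -[RHS]raddfD subrK.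
  pose invM := GRing.isZmodMorphism.Build _ _ homt_inv invB.
  pose invA := HB.pack_for
    {additive linhom (lhom C X) E -> tensor X (bhom C E)} homt_inv invM.
  apply: (tensor_ext (f := invA \o @homt X) (g := idfun)) => x f /=.
  rewrite /homt_inv [in RHS](eE x) tens_suml; apply: eq_bigr => i _.
  by rewrite Z; congr tens; apply: homP => c /=; rewrite homtE.
apply: homP => g; rewrite /homt_inv raddf_sum sum_homE.
have {2}-> : g = \sum_(i < n) lcoev i ((g : linhom X (rmod C)) (e i)).
  apply: homP => x; rewrite [RHS]sum_homE {1}(eE x) linear_sum.
  by apply: eq_bigr => i _; rewrite linearZ.
by rewrite linear_sum; apply: eq_bigr => i _; rewrite homtE.
Qed.
End DualBasis.
End TensorHomEvaluation.

(** * Short exact sequences *)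

Lemma inj_surj_bij (T U : Type) (f : T -> U) :
  injective f -> (forall y, exists x, f x = y) -> bijective f.
Proof.
move=> f_inj /choice[g fK]; exists g => // x.
by apply: f_inj; rewrite fK.
Qed.

Lemma bij_surj (T U : Type) (f : T -> U) : bijective f -> forall y, exists x, f x = y.
Proof. by case=> g _ fK y; exists (g y). Qed.

Record short_exact (R : pzRingType) (M' M M'' : lmodType R)
    (a : {linear M' -> M}) (p : {linear M -> M''}) : Prop := ShortExact {
  ses_inj : injective a;
  ses_exact : exact_at a p;
  ses_surj : forall x, exists y, p y = x
}.

Lemma sesK (R : pzRingType) (M' M M'' : lmodType R)
    (a : {linear M' -> M}) (p : {linear M -> M''}) :
  short_exact a p -> forall x, p (a x) = 0.
Proof. by move=> ses x; apply/(ses_exact ses); exists x. Qed.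

Section ExtSequence.
Variables (R : pzRingType) (A : lmodType R) (P : resolution A).
Hypothesis projP : projective_resolution P.
Variables (N' N N'' : lmodType R) (a : {linear N' -> N}) (p : {linear N -> N''}).
Hypothesis ses : short_exact a p.

Lemma hom_post_exact (U : lmodType R) :
  exact_at (hom_post (U := U) a) (hom_post (U := U) p).
Proof.
move=> f; split=> [pf|[g <-]]; last by apply: homP => x; apply: (sesK ses).
have [x|g gE] := factor_inj (f := f) (ses_inj ses).
  by apply/(ses_exact ses); apply: homE pf x.
by exists g; apply: homP.
Qed.

Lemma hom_post_inj (U : lmodType R) : injective (hom_post (U := U) a).
Proof.
by move=> f g /homE fg; apply: homP => x; apply: (ses_inj ses); apply: fg.
Qed.

(** Index 0 is left out because [aobj P 0] is [A], which need not be projective. *)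
Lemma hom_post_surj i (f : linhom (aobj P i.+1) N'') : exists g, hom_post p g = f.
Proof.
have [x|g gE] := projective_lift (f := f) (d := p) (@projP i); first exact: (ses_surj ses).
by exists g; apply: homP.
Qed.

Lemma hom_preK i (L : lmodType R) (f : linhom (aobj P i) L) :
  hom_pre (adiff P i.+1) (hom_pre (adiff P i) f) = 0.
Proof. by apply: homP => x; rewrite /= adiffK linear0. Qed.

(** A cocycle with values in [N''] lifts to one with values in [N], which is a coboundary. This
    serves both the acyclicity of [N''] and, at [i = 0], the lifting of maps on [A]. *)
Lemma ext_lift i (f : linhom (aobj P i.+1) N'') :
  ext_acyclic P N' -> ext_acyclic P N -> hom_pre (adiff P i.+1) f = 0 ->
  exists g : linhom (aobj P i) N, hom_pre (adiff P i) (hom_post p g) = f.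
Proof.
move=> extN' extN; have [h <-] := hom_post_surj f => hd.
have [|||||k /extN[g <-] gk] := lift_cycle
  (dX' := hom_pre (adiff P i.+1)) (dX := hom_pre (adiff P i.+1))
  (dY := hom_pre (adiff P i.+2)) (dX'' := hom_pre (adiff P i.+1))
  (aX := hom_post a) (pX := hom_post p) (pY := hom_post p)
  _ _ _ (x := h) _ _ (@hom_post_exact _) (@hom_post_inj _) (extN' i.+1) hd.
1-3: by move=> k; apply: homP.
- exact: hom_preK.
- by move=> k; apply/hom_post_exact; exists k.
by exists g; rewrite -gk; apply: homP.
Qed.

Lemma ext_acyclic_coker : ext_acyclic P N' -> ext_acyclic P N -> ext_acyclic P N''.
Proof.
move=> extN' extN i f; split=> [|[g <-]]; last exact: hom_preK.
by move=> /(ext_lift extN' extN)[g gf]; exists (hom_post p g).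
Qed.

Lemma hom_post_surj0 : ext_acyclic P N' -> ext_acyclic P N ->
  forall f : linhom A N'', exists g, hom_post p g = f.
Proof.
move=> extN' extN f.
have [|g gf] := ext_lift (i := 0) (f := hom_pre (adiff P 0) f) extN' extN.
  exact: (hom_preK (i := 0)).
exists g; apply: homP => x; have [y <-] := adiff_surj P x.
exact: (homE gf y).
Qed.

(** The surjectivity assumption replaces projectivity in index 0; it is what makes Ext^1(A, N')
    vanish. *)
Lemma ext_acyclic_ker : (forall f : linhom A N'', exists g, hom_post p g = f) ->
  ext_acyclic P N -> ext_acyclic P N'' -> ext_acyclic P N'.
Proof.
move=> surj0 extN extN'' [|i]; first exact: ext_acyclic0.
move=> f; split=> [fd|[g <-]]; last exact: hom_preK.
have /extN[h hE] : hom_pre (adiff P i.+2) (hom_post a f) = 0.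
  transitivity (hom_post a (hom_pre (adiff P i.+2) f)); first exact: homP.
  by rewrite fd raddf0.
apply: (lift_boundary (dW := hom_pre (adiff P i)) (dW'' := hom_pre (adiff P i))
  (dX' := hom_pre (adiff P i.+1)) (dX := hom_pre (adiff P i.+1))
  (dX'' := hom_pre (adiff P i.+1)) (pW := hom_post p) (pX := hom_post p)
  (pY := hom_post p) _ _ _ _ _ (@hom_post_exact _) (@hom_post_inj _) _
  (extN'' i) (esym hE)).
1-3: by move=> k; apply: homP.
- exact: hom_preK.
- by move=> k; apply/hom_post_exact; exists k.
- by case: i {f fd h hE} => [|i]; [exact: surj0 | exact: hom_post_surj].
Qed.
End ExtSequence.

(** Flatness of the right module [X], in its injectivity form; [flat] is about left modules. *)
Definition tensor_exact (R : pzRingType) (X : lmodType R^c) : Prop :=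
  forall (M M' : lmodType R) (g : {linear M -> M'}),
    injective g -> injective (tensor_map (idfun : {linear X -> X}) g).

Section TorSequence.
Variables (R : pzRingType) (A : lmodType R^c) (Q : resolution A).
Hypothesis flatQ : forall i, tensor_exact (Q i).
Variables (M' M M'' : lmodType R) (a : {linear M' -> M}) (p : {linear M -> M''}).
Hypothesis ses : short_exact a p.

Local Notation post i g := (tensor_map (idfun : {linear aobj Q i -> aobj Q i}) g).

Lemma tdiff_natural (L L' : lmodType R) (g : {linear L -> L'}) i t :
  post i g (tdiff Q L i t) = tdiff Q L' i (post i.+1 g t).
Proof. exact: tensor_map_square. Qed.

Lemma post_exact i : exact_at (post i a) (post i p).
Proof. by apply: tensor_right_exactr; [exact: ses_exact ses | exact: ses_surj ses]. Qed.

Lemma post_surj i t : exists u, post i p u = t.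
Proof. by apply: tensor_map_surj => x; [exists x | exact: (ses_surj ses)]. Qed.

Lemma postK i t : post i p (post i a t) = 0.
Proof. by apply/post_exact; exists t. Qed.

(** Since [A] need not be flat, injectivity in index 0 is assumed; it is what makes Tor_1(A, M'')
    vanish. *)
Lemma tor_acyclic_coker : injective (post 0 a) ->
  tor_acyclic Q M' -> tor_acyclic Q M -> tor_acyclic Q M''.
Proof.
move=> inj0 torM' torM [|i]; first exact: tor_acyclic0.
move=> t; split=> [dt|[u <-]]; last exact: tdiffK.
have [u ut] := post_surj t.
have inji : injective (post i a) by case: i {t u dt ut} => [|i] //; apply: flatQ (ses_inj ses).
have [||||||v /torM[w <-]] := lift_cycle
  (dX' := tdiff Q M' i.+1) (dX := tdiff Q M i.+1)
  (dY := tdiff Q M i) (dX'' := tdiff Q M'' i.+1)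
  (aX := post i.+2 a) (pX := post i.+2 p) (pY := post i.+1 p)
  _ _ _ (x := u) _ _ (@post_exact i.+1) inji (torM' i).
- exact: tdiff_natural.
- exact: tdiff_natural.
- exact: tdiff_natural.
- exact: tdiffK.
- exact: postK.
- by rewrite /= ut.
move=> wE; exists (post i.+3 p w).
by rewrite -ut -[RHS]wE; apply: esym; apply: tdiff_natural.
Qed.

Lemma tor_lift_boundary i (y : tensor (aobj Q i.+1) M') x :
  tor_acyclic Q M'' -> post i.+1 a y = tdiff Q M i.+1 x ->
  exists x', tdiff Q M' i.+1 x' = y.
Proof.
move=> torM'' yx.
apply: (lift_boundary (dW := tdiff Q M i.+2) (dW'' := tdiff Q M'' i.+2)
  (dX := tdiff Q M i.+1) (dX'' := tdiff Q M'' i.+1)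
  (pW := post i.+3 p) (pX := post i.+2 p)
  (pY := post i.+1 p) _ _ _ _ _ (@post_exact i.+2) _ _
  (torM'' i.+1) yx).
- exact: tdiff_natural.
- exact: tdiff_natural.
- exact: tdiff_natural.
- exact: tdiffK.
- exact: postK.
- exact: flatQ (ses_inj ses).
- exact: post_surj.
Qed.

Lemma tor_acyclic_ker : tor_acyclic Q M -> tor_acyclic Q M'' -> tor_acyclic Q M'.
Proof.
move=> torM torM'' i t; split=> [dt|[u <-]]; last exact: tdiffK.
have /torM[x xE] : tdiff Q M i (post i.+1 a t) = 0.
  by rewrite -tdiff_natural dt raddf0.
exact: tor_lift_boundary (esym xE).
Qed.

(** The segment Tor_1(A, M'') -> A (x) M' -> A (x) M of the long exact sequence, with its first term
    zero. *)
Lemma post0_inj : tor_acyclic Q M'' -> injective (post 0 a).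
Proof.
move=> torM''; apply: raddf_inj => t; have [y <-] := tdiff_surj Q t.
move=> /(etrans (esym (tdiff_natural a y)))/tor_acyclic0[x xE].
have [x' <-] := tor_lift_boundary torM'' (esym xE).
exact: tdiffK.
Qed.
End TorSequence.

(** * The Auslander and Bass classes *)

Lemma projective_tensor_exact (R : pzRingType) (X : lmodType R^c) :
  projective X -> finitely_generated X -> tensor_exact X.
Proof.
move=> projX fgX; have [n [e [phi eE]]] := projective_dual_basis projX fgX.
by move=> M M' g; apply: projective_tensor_inj eE _ _ _.
Qed.

Lemma flat_tensor_inj (R : pzRingType) (F : lmodType R) (A B : lmodType R^c)
    (f : {linear A -> B}) :
  flat F -> injective f -> injective (tensor_map f (idfun : {linear F -> F})).
Proof.
move=> flatF f_inj; apply: raddf_inj => t.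
(* Injectivity of [f] is exactness after a zero map, a form to which [flat] applies. *)
have ex0 : exact_at (\0 : {linear A -> A}) f.
  move=> a; split=> [fa|[b <-]]; last exact: linear0.
  by exists 0; apply: f_inj; rewrite fa linear0.
move=> /(flatF _ _ _ _ _ ex0)[u <-].
move: u; apply: (tensor_ext
  (f := tensor_map (\0 : {linear A -> A}) (idfun : {linear F -> F})) (g := \0)) => a m.
by rewrite /= tensor_mapE tens0l.
Qed.

(* Hom_Z(K, K) as a right R-module. *)
Definition zend (R : pzRingType) (K : lmodType R) : Type :=
  linhom (zmodule K) (zmodule K).

Section EndModule.
Variables (R : pzRingType) (K : lmodType R).

HB.instance Definition _ := GRing.Zmodule.on (zend K).

Section Scale.
Variable r : R.
Let g (x : zmodule K) : zmodule K := r *: (x : K).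
Fact zend_scale_is_linear : linear g.
Proof.
move=> n x y; rewrite /g [LHS](scalerDr r (_ : K)); congr (_ + _).
exact: esym (scalerMzr r (x : K) n).
Qed.
HB.instance Definition _ :=
  GRing.isLinear.Build int (zmodule K) (zmodule K) _ g zend_scale_is_linear.
Definition zend_scale (f : zend K) : zend K :=
  hom_pre (g : {linear zmodule K -> zmodule K}) f.
End Scale.

Fact zend_scaleA (a b : R^c) f : zend_scale a (zend_scale b f) = zend_scale (a * b : R^c) f.
Proof. by apply: homP => x; congr (f _); apply: (scalerA (b : R) a (x : K)). Qed.
Fact zend_scale1 : left_id (1 : R^c) zend_scale.
Proof. by move=> f; apply: homP => x; congr (f _); apply: (scale1r (x : K)). Qed.
Fact zend_scaleDr : @right_distributive R^c _ zend_scale +%R.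
Proof. by move=> r f g; apply: homP. Qed.
Fact zend_scaleDl f : {morph (zend_scale^~ f : R^c -> _) : a b / a + b}.
Proof.
move=> a b; apply: homP => x; rewrite -[RHS](linearD f); congr (f _).
exact: (scalerDl (x : K)).
Qed.

HB.instance Definition _ := GRing.Zmodule_isLmodule.Build R^c (zend K)
  zend_scaleA zend_scale1 zend_scaleDr zend_scaleDl.
End EndModule.

Section Classes.
Variables (S R : pzRingType) (C : bimodType S R).
Variables (P : resolution C) (Q : resolution (rmod C)).
Hypotheses (projP : projective_resolution P) (projQ : projective_resolution Q).
Hypotheses (fgP : forall i, finitely_generated (P i)).
Hypotheses (fgQ : forall i, finitely_generated (Q i)).
Hypothesis hC : faithfully_semidualizing C.

Let flatQ i : tensor_exact (Q i).
Proof. exact: projective_tensor_exact. Qed.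

(** * Flat modules lie in the Auslander class *)

Section Flat.
Variable F : lmodType R.
Hypothesis flatF : flat F.
Local Notation idF := (idfun : {linear F -> F}).

Lemma thom_resolution_bij i : bijective (@thom S R C F (aobj P i.+1)).
Proof.
have [n [e [phi eE]]] := projective_dual_basis (@projP i) (fgP i).
exact: thom_bij eE.
Qed.

(** Through [thom], the cocycle becomes a cycle of the complex Hom_S(P, C) (x) F, which is exact by
    (c1) and flatness. At [i = 0] the element [t] lies in Hom_S(C, C) (x) F. *)
Lemma flat_thom_cocycle i (f : linhom (aobj P i.+1) (btensor C F)) :
  hom_pre (adiff P i.+1) f = 0 ->
  exists t : tensor (rhom C (aobj P i)) F, hom_pre (adiff P i) (thom t) = f.
Proof.
have [t <-] := bij_surj (thom_resolution_bij i) f => td.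
have exC : exact_at (rhom_pre C (adiff P i)) (rhom_pre C (adiff P i.+1)).
  by have extC := Ext_eq0_acyclic projP (sd_c1 (fsd_sd hC)); apply: extC.
have /(flatF exC)[u <-] : tensor_map (rhom_pre C (adiff P i.+1)) idF t = 0.
  by apply: (bij_inj (thom_resolution_bij i.+1)); rewrite thom_natural td raddf0.
by exists u; rewrite thom_natural.
Qed.

(** Though C need not be projective, bijectivity descends from [P 0] and [P 1], since both sides are
    kernels of corresponding maps. *)
Lemma flat_thom0_bij : bijective (@thom S R C F C).
Proof.
apply: inj_surj_bij => [|g].
  apply: raddf_inj => t t0.
  have inj0 : injective (rhom_pre C (adiff P 0)).
    move=> f g /homE fg; apply: homP => x; have [y <-] := adiff_surj P x.
    exact: fg.
  apply: (flat_tensor_inj flatF inj0).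
  apply: (bij_inj (thom_resolution_bij 0)).
  by rewrite thom_natural t0 !raddf0.
have [|t tE] := flat_thom_cocycle (i := 0) (f := hom_pre (adiff P 0) g).
  exact: (hom_preK (i := 0)).
exists t; apply: homP => x; have [y <-] := adiff_surj P x.
exact: (homE tE y).
Qed.

(** By (b2), [m] |-> [one] (x) [m] identifies F with Hom_S(C, C) (x) F; followed by [thom] at C it
    is [mu]. *)
Lemma flat_mu_bij : bijective (@mu S R C F).
Proof.
have [rho rhoK Krho] := sd_b2 (fsd_sd hC).
have [Dl Dr Z] := tens_balanced (rhom C C) F.
have homothetyD r r' : homothety_r C (r + r') = homothety_r C r + homothety_r C r'.
  by apply: homP => c; apply: rscaleDr.
pose one : rhom C C := homothety_r C 1.
have oneZ r : (r : R^c) *: one = homothety_r C r.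
  by apply: homP => c; rewrite -[RHS]/(rscale c r) -[in RHS](rscale1 c).
pose k (h : rhom C C) (m : F) : F := rho h *: m.
have kb : balanced k.
  split=> [f g m|f m n|f r m]; rewrite /k.
  - rewrite -scalerDl; congr (_ *: m); apply: (can_inj rhoK).
    by rewrite homothetyD !Krho.
  - exact: scalerDr.
  - rewrite scalerA; congr (_ *: m); apply: (can_inj rhoK); rewrite Krho.
    apply: homP => c; rewrite -[RHS]/(rscale c _) -rscaleA.
    by rewrite -{1}[f]Krho.
pose unit (m : F) := tens one m.
have unit_bij : bijective unit.
  exists (tlift k) => [m|].
    by rewrite tliftE // /k /one rhoK scale1r.
  pose kM := GRing.isZmodMorphism.Build _ _ (tlift k) (tlift_is_zmod_morphism kb).
  pose K := HB.pack_for {additive tensor (rhom C C) F -> F} (tlift k) kM.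
  have uB : zmod_morphism unit.
    by move=> m n; apply/eqP; rewrite /unit eq_sym subr_eq -Dr subrK.
  pose uM := GRing.isZmodMorphism.Build _ _ unit uB.
  pose u := HB.pack_for {additive F -> tensor (rhom C C) F} unit uM.
  apply: (tensor_ext (f := u \o K) (g := idfun)) => f m.
  by rewrite /= tliftE // /k /unit -Z oneZ Krho.
apply: (eq_bij (bij_comp flat_thom0_bij unit_bij)) => m.
by apply: homP => c; rewrite /= thomE /= rscale1.
Qed.

Lemma flat_tor_acyclic : tor_acyclic Q F.
Proof. by move=> i; apply: flatF; apply: adiff_exact. Qed.

Lemma flat_ext_acyclic : ext_acyclic P (btensor C F).
Proof.
move=> i f; split=> [/flat_thom_cocycle[t <-]|[g <-]]; first by exists (thom t).
exact: hom_preK.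
Qed.
End Flat.

(** * Injective modules lie in the Bass class *)

Section Injective.
Variable E : lmodType S.
Hypothesis injE : injective_module E.
Local Notation H := (bhom C E).

Lemma injective_ext_acyclic : ext_acyclic P E.
Proof.
move=> i f; split=> [fd|[g <-]]; last exact: hom_preK.
have [x|g gE] := injective_extend (f := f) injE (adiff_exact P i).
  exact: (homE fd x).
by exists g; apply: homP.
Qed.

Lemma homt_resolution_bij i : bijective (@homt S R C E (aobj Q i.+1)).
Proof.
have [n [e [phi eE]]] := projective_dual_basis (@projQ i) (fgQ i).
exact: homt_bij eE.
Qed.

(** By (c2) and injectivity of E, the functional [homt t] extends along the next differential, and
    the extension is some [homt u]. The hypothesis is put on the side of functionals so that [i = 0]
    can serve to prove injectivity of [homt] at C. *)
Lemma injective_homt_cycle i (t : tensor (aobj Q i.+1) H) :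
  hom_pre (lhom_pre C (adiff Q i)) (homt t) = 0 -> exists u, tdiff Q H i.+1 u = t.
Proof.
move=> td.
have exC : exact_at (lhom_pre C (adiff Q i)) (lhom_pre C (adiff Q i.+1)).
  by have extC := Ext_eq0_acyclic projQ (sd_c2 (fsd_sd hC)); apply: extC.
have [x|w wE] := injective_extend (f := homt t) injE exC.
  exact: (homE td x).
have [u uE] := bij_surj (homt_resolution_bij i.+1) w.
exists u; apply: (bij_inj (homt_resolution_bij i)).
by rewrite [LHS]homt_natural uE; apply: homP.
Qed.

Lemma injective_homt0_bij : bijective (@homt S R C E (rmod C)).
Proof.
apply: inj_surj_bij => [|w].
  apply: raddf_inj => t; have [u <-] := tdiff_surj Q t => u0.
  have [|v <-] := injective_homt_cycle (i := 0) (t := u); last exact: (tdiffK Q _ 0).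
  by rewrite -homt_natural.
have inj0 : injective (lhom_pre C (adiff Q 0)).
  move=> f g /homE fg; apply: homP => x; have [y <-] := adiff_surj Q x.
  exact: fg.
have [v vE] := injE w inj0.
have [t tE] := bij_surj (homt_resolution_bij 0) v.
exists (tdiff Q H 0 t).
by rewrite [LHS]homt_natural tE; apply: homP.
Qed.

(** By (b1), evaluation at [one] identifies the functionals on Hom_R^op(C, C) with E; preceded by
    [homt] at C it is [nu]. *)
Lemma injective_nu_bij : bijective (@nu S R C E).
Proof.
have [sg sgK Ksg] := sd_b1 (fsd_sd hC).
pose one : lhom C (rmod C) := homothety_l C 1.
have oneZ s : s *: one = homothety_l C s.
  by apply: homP => c; rewrite /= /homothety_l /=; congr (s *: _); apply: (scale1r (c : C)).
pose ev (w : linhom (lhom C (rmod C)) E) : E := w one.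
have ev_bij : bijective ev.
  apply: inj_surj_bij => [w v wv|y].
    apply: homP => f; rewrite -[f]Ksg -oneZ !linearZ_LR.
    by rewrite [w one]wv.
  pose h (f : lhom C (rmod C)) : E := sg f *: y.
  have hl : linear h.
    move=> s f g; rewrite /h scalerA -scalerDl; congr (_ *: y).
    apply: (can_inj sgK); rewrite Ksg -oneZ scalerDl -scalerA !oneZ !Ksg.
    by [].
  pose hM := GRing.isLinear.Build S (lhom C (rmod C)) E _ h hl.
  exists (HB.pack_for {linear lhom C (rmod C) -> E} h hM : linhom _ _).
  by rewrite /ev /= /h /one sgK scale1r.
apply: (eq_bij (bij_comp ev_bij injective_homt0_bij)).
have evB : zmod_morphism ev by [].
pose evM := GRing.isZmodMorphism.Build _ _ ev evB.
pose evA := HB.pack_for {additive linhom (lhom C (rmod C)) E -> E} ev evM.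
apply: (tensor_ext (f := evA \o @homt S R C E (rmod C)) (g := @nu S R C E)) => c f.
rewrite /= /ev homtE nuE; congr (_ _); exact: (scale1r (c : C)).
Qed.

Lemma injective_tor_acyclic : tor_acyclic Q H.
Proof.
move=> i t; split=> [dt|[u <-]]; last exact: tdiffK.
by apply: injective_homt_cycle; rewrite -homt_natural [X in homt X]dt raddf0.
Qed.
End Injective.

(** * Membership tested on fixed resolutions; closure properties and induction *)

Definition in_auslander (M : lmodType R) : Prop :=
  [/\ tor_acyclic Q M, ext_acyclic P (btensor C M) & bijective (@mu S R C M)].

Definition in_bass (N : lmodType S) : Prop :=
  [/\ ext_acyclic P N, tor_acyclic Q (bhom C N) & bijective (@nu S R C N)].

Lemma in_auslanderP M : in_auslander M -> auslander C M.
Proof.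
case=> torM extM muM; split=> //; first exact: acyclic_Tor_eq0 torM.
exact: acyclic_Ext_eq0 extM.
Qed.

Lemma in_bassP N : in_bass N -> bass C N.
Proof.
case=> extN torN nuN; split=> //; first exact: acyclic_Ext_eq0 extN.
exact: acyclic_Tor_eq0 torN.
Qed.

Lemma flat_in_auslander F : flat F -> in_auslander F.
Proof.
move=> flatF; split; first exact: flat_tor_acyclic.
  exact: flat_ext_acyclic.
exact: flat_mu_bij.
Qed.

Lemma injective_in_bass E : injective_module E -> in_bass E.
Proof.
move=> injE; split; first exact: injective_ext_acyclic.
  exact: injective_tor_acyclic.
exact: injective_nu_bij.
Qed.

(* A map [C -> ker (C (x) a)] is [mu m'] for some [m'] with [a m' = 0], hence *)
(* zero; faithfulness then kills the kernel.                                  *)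
Lemma btensor_map_inj (M' M : lmodType R) (a : {linear M' -> M}) :
  bijective (@mu S R C M') -> injective (@mu S R C M) -> injective a ->
  injective (btensor_map C a).
Proof.
move=> muM' muM a_inj.
have ker0 : trivial_group (kernel (btensor_map C a)).
  apply: (fsd_l hC) => k.
  have [m mE] := bij_surj muM' (hom_post (ker_incl (btensor_map C a)) k).
  have am0 : a m = 0.
    apply: muM; rewrite mu_natural mE linear0.
    by apply: homP => c; apply: kerP.
  have m0 : m = 0 by apply: a_inj; rewrite am0 linear0.
  apply: homP => c; apply: val_inj.
  have := homE mE c; rewrite m0 linear0 => kc0.
  by rewrite [RHS](linear0 (ker_incl (btensor_map C a))); exact: esym.
apply: raddf_inj => t /kerK[k <-].
by rewrite (ker0 k).
Qed.

(** Injectivity of C (x) [a] keeps the sequence short exact after tensoring with C. The two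
    acyclicity conditions then pass to [M''], and [mu] is compared on the three modules as in the
    five lemma. *)
Lemma auslander_coker (M' M M'' : lmodType R) (a : {linear M' -> M})
    (p : {linear M -> M''}) :
  short_exact a p -> in_auslander M' -> in_auslander M -> in_auslander M''.
Proof.
move=> ses [torM' extM' muM'] [torM extM muM].
have ca_inj := btensor_map_inj muM' (bij_inj muM) (ses_inj ses).
have cses : short_exact (btensor_map C a) (btensor_map C p).
  split=> //; first by apply: tensor_right_exactr (ses_exact ses) (ses_surj ses).
  apply: tensor_map_surj => x; [by exists x | exact: (ses_surj ses)].
split; first exact: (tor_acyclic_coker flatQ ses).
  exact: (ext_acyclic_coker projP cses).
apply: inj_surj_bij => [|g].
  apply: raddf_inj => m''; have [m <-] := ses_surj ses m''.
  move=> /(etrans (esym (mu_natural _ p m)))/(hom_post_exact cses)[g ga].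
  have [m' m'E] := bij_surj muM' g.
  have -> : m = a m'; last exact: (sesK ses).
  by apply: (bij_inj muM); rewrite mu_natural m'E.
have [h hE] := hom_post_surj0 projP cses extM' extM g.
have [m mE] := bij_surj muM h.
by exists (p m); rewrite mu_natural mE.
Qed.

(** Terms vanish from index [n] on, so [n = 0] means [M = 0], which is flat. Otherwise [M] is the
    cokernel of its first syzygy in [F 0], and the syzygy is resolved by the shifted complex. *)
Lemma auslander_flat_dimension n (M : lmodType R) (F : resolution M) :
  (forall i, flat (F i)) -> (forall i, (n <= i)%N -> trivial_group (F i)) ->
  in_auslander M.
Proof.
elim: n M F => [|n IHn] M F flatF F0.
  apply: flat_in_auslander => A B D f g _ t.
  have M0 (m : M) : m = 0.
    by have [y <-] := res_aug_surj F m; rewrite (F0 0%N isT y) linear0.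
  have T0 (X : lmodType R^c) (u : tensor X M) : u = 0.
    move: u; apply: tensor_ind => // [x y -> ->|x m]; first exact: subrr.
    by rewrite (M0 m) tens0r.
  split=> _; last exact: T0.
  by exists 0; rewrite [RHS]T0 raddf0.
pose K := kernel (res_aug F).
have augd x : res_aug F (res_diff F 0 x) = 0 by exact: (adiffK F 0).
have ses : short_exact (ker_incl (res_aug F)) (res_aug F).
  split; [exact: val_inj | | exact: res_aug_surj].
  by move=> x; split=> [/kerK|[k <-]]; last exact: kerP.
have [G [GF flatG]] : exists G : resolution K,
    (forall i, flat (G i)) /\ (forall i, (n <= i)%N -> trivial_group (G i)).
  have l_surj (k : K) : exists x, ker_lift augd x = k.
    have /(adiff_exact F 0)[x xE] := kerP k.
    by exists x; apply: val_inj.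
  have l_exact : exact_at (res_diff F 1) (ker_lift augd).
    move=> x; split=> [/(congr1 val)/= x0|/(adiff_exact F 1) x0].
      exact/(adiff_exact F 1).
    exact: val_inj.
  exists (@Resolution R K (fun i => F i.+1) (fun i => res_diff F i.+1)
    (ker_lift augd) l_surj l_exact (fun i => adiff_exact F i.+2)).
  by split=> i; [exact: flatF | exact: (F0 i.+1)].
exact: auslander_coker ses (IHn _ G GF flatG) (flat_in_auslander (flatF 0%N)).
Qed.

(* Tensor-Hom adjunction turns right-linear maps [C -> Hom_Z(K, K)] into *)
(* additive maps on [C (x) K].                                           *)
Lemma btensor_trivial (K : lmodType R) :
  trivial_group (btensor C K) -> trivial_group K.
Proof.
move=> CK0; have end0 : trivial_group (zend K).
  apply: (fsd_r hC) => k.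
  pose h (c : rmod C) (x : K) : K := (k c : linhom _ _) x.
  have hb : balanced h.
    split=> [c c' x|c x y|c r x]; rewrite /h.
    - by rewrite linearD.
    - exact: (linearD (k c : linhom (zmodule K) (zmodule K))).
    - by rewrite linearZ_LR.
  apply: homP => c; apply: homP => x.
  rewrite -[LHS](tliftE hb c x) (CK0 (tens c x)).
  pose hM := GRing.isZmodMorphism.Build _ _ (tlift h) (tlift_is_zmod_morphism hb).
  exact: (raddf0 (HB.pack_for {additive tensor (rmod C) K -> K} (tlift h) hM)).
by move=> x; apply: (homE (end0 (idfun : {linear zmodule K -> zmodule K})) x).
Qed.

(** Tensoring with C kills the cokernel of [u], so [btensor_trivial] applies to it. *)
Lemma btensor_map_surj (A B : lmodType R) (u : {linear A -> B}) :
  (forall t, exists s, btensor_map C u s = t) -> forall b, exists a, u a = b.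
Proof.
move=> Cu b; apply/coker_proj_eq0; apply: btensor_trivial => t.
have [s <-] : exists s, btensor_map C (coker_proj u : {linear B -> coker u}) s = t.
  by apply: tensor_map_surj => x; [exists x | apply: coker_proj_surj].
have [r <-] := Cu s; apply: tensor_map_comp0r => a.
by apply/coker_proj_eq0; exists a.
Qed.

Lemma bass_ker (N' N N'' : lmodType S) (a : {linear N' -> N}) (p : {linear N -> N''}) :
  short_exact a p -> in_bass N -> in_bass N'' -> in_bass N'.
Proof.
move=> ses [extN torN nuN] [extN'' torN'' nuN''].
(* After tensoring with C, this map is identified with the surjection [p] through [nu] on [N] and
   [N'']. *)
have hom_surj : forall f, exists g, bhom_post C p g = f.
  apply: (btensor_map_surj (u := bhom_post C p)) => t.
  have [n nE] := ses_surj ses (nu t); have [s sE] := bij_surj nuN n.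
  by exists s; apply: (bij_inj nuN''); rewrite nu_natural sE.
have hses : short_exact (bhom_post C a) (bhom_post C p).
  split; last exact: hom_surj.
    exact: (hom_post_inj ses (U := C)).
  exact: (hom_post_exact ses (U := C)).
split; first exact: (ext_acyclic_ker projP ses).
  exact: (tor_acyclic_ker flatQ hses).
have Ca_inj := post0_inj flatQ hses torN''.
apply: inj_surj_bij => [|n].
  apply: raddf_inj => t t0; apply: Ca_inj; rewrite [RHS]raddf0.
  apply: (bij_inj nuN); apply: (etrans (nu_natural a t)).
  by rewrite [nu t]t0 linear0 raddf0.
have [t tE] := bij_surj nuN (a n).
have Cpt : btensor_map C (bhom_post C p) t = 0.
  by apply: (bij_inj nuN''); rewrite nu_natural tE (sesK ses) raddf0.
have [s sE] : exists s, btensor_map C (bhom_post C a) s = t.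
  by apply/(tensor_right_exactr (ses_exact hses) (ses_surj hses)).
by exists s; apply: (ses_inj ses); rewrite -nu_natural sE.
Qed.

(** Induction on the cosyzygy, taken as the kernel of the second differential, which by exactness is
    the image of the first; the shifted complex coresolves it. At [n = 0] the module embeds in
    zero. *)
Lemma bass_injective_dimension n (N : lmodType S) (E : coresolution N) :
  (forall i, injective_module (E i)) -> (forall i, (n <= i)%N -> trivial_group (E i)) ->
  in_bass N.
Proof.
elim: n N E => [|n IHn] N E injE E0.
  apply: injective_in_bass => A B j f _; exists \0 => x.
  by apply: (cores_aug_inj (c := E)); rewrite [LHS](E0 0%N isT) [RHS](E0 0%N isT).
pose K := kernel (cores_diff E 1).
have dd x : cores_diff E 1 (cores_diff E 0 x) = 0.
  by apply/(cores_exact (c := E) (i := 0)); exists x.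
have ses : short_exact (cores_aug E) (ker_lift dd).
  split; first exact: cores_aug_inj.
    move=> x; split=> [/(congr1 val)/= x0|/(cores_exact0 (c := E)) x0].
      exact/(cores_exact0 (c := E)).
    exact: val_inj.
  move=> k; have /(cores_exact (c := E) (i := 0))[x xE] := kerP k.
  by exists x; apply: val_inj.
have [G [GE injG]] : exists G : coresolution K,
    (forall i, injective_module (G i)) /\ (forall i, (n <= i)%N -> trivial_group (G i)).
  have k_exact : exact_at (ker_incl (cores_diff E 1)) (cores_diff E 1).
    by move=> x; split=> [/kerK|[k <-]]; last exact: kerP.
  exists (@Coresolution S K (fun i => E i.+1) (fun i => cores_diff E i.+1)
    (ker_incl _) val_inj k_exact (fun i => @cores_exact _ _ E i.+1)).
  by split=> i; [exact: injE | exact: (E0 i.+1)].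
exact: bass_ker ses (injective_in_bass (injE 0%N)) (IHn _ G GE injG).
Qed.

End Classes.

Theorem corollary6p6 (R S : pzRingType) (C : bimodType S R)
    (hC : faithfully_semidualizing C) :
  [/\ forall M : lmodType R, finite_flat_dimension M -> auslander C M,
      forall M : lmodType R, finitely_generated M -> finite_flat_dimension M ->
        fg_part (auslander C) M
    & forall N : lmodType S, finite_injective_dimension N -> bass C N].
Proof.
have [P resP] := sd_a1 (fsd_sd hC); have [Q resQ] := sd_a2 (fsd_sd hC).
have projP i := (resP i).1; have fgP i := (resP i).2.
have projQ i := (resQ i).1; have fgQ i := (resQ i).2.
have flat_dim M : finite_flat_dimension M -> auslander C M.
  move=> [F [n [flatF F0]]]; apply: (in_auslanderP projP projQ).
  (* Dimension at most [n] means vanishing from index [n.+1] on. *)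
  exact: (auslander_flat_dimension projP projQ fgP fgQ hC (n := n.+1) flatF).
split=> // [M fgM ffdM|N [E [n [injE E0]]]]; first by split=> //; apply: flat_dim.
apply: (in_bassP projP projQ).
exact: (bass_injective_dimension projP projQ fgQ hC (n := n.+1) injE).
Qed.
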